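(* The functor $\tilde H_0:\mathsf{CNOT}\to\mathsf{ParIso}(\mathsf{CTor}_2)^*$ is full and faithful on restriction idempotents: for every $n$, every restriction idempotent of $\mathbb{Z}_2^n$ in $\mathsf{ParIso}(\mathsf{CTor}_2)^*$ is $\tilde H_0(e)$ for some restriction idempotent $e:n\to n$ of $\mathsf{CNOT}$, and if $e,e':n\to n$ are restriction idempotents of $\mathsf{CNOT}$ with $\tilde H_0(e)=\tilde H_0(e')$ then $e=e'$.
   Context: $\mathsf{CNOT}$ is the strict symmetric monoidal category with objects the natural numbers ($n\otimes m=n+m$), generated by $\mathsf{cnot}:2\to2$, $|1\rangle:0\to1$, $\langle1|:1\to0$ (and the symmetry $\sigma$), subject exactly to the identities below; composition is diagrammatic ($fg$ = first $f$ then $g$); $C_{i\to j}$ is the $\mathsf{cnot}$ gate with control wire $i$ and target wire $j$ (wires numbered top to bottom; $\mathsf{cnot}$ has control on its first wire). Identities: (CNT.1) $C_{1\to2}C_{2\to1}C_{1\to2}=\sigma$; (CNT.2) $C_{1\to2}C_{1\to2}=1_2$; (CNT.3) $C_{2\to1}C_{2\to3}=C_{2\to3}C_{2\to1}$; (CNT.4) $(|1\rangle\otimes1_1)C_{1\to2}=(|1\rangle\otimes1_1)C_{1\to2}(\langle1|\otimes1_1)(|1\rangle\otimes1_1)$ and $C_{1\to2}(\langle1|\otimes1_1)=(\langle1|\otimes1_1)(|1\rangle\otimes1_1)C_{1\to2}(\langle1|\otimes1_1)$; (CNT.5) $C_{1\to2}C_{3\to2}=C_{3\to2}C_{1\to2}$;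 (CNT.6) $|1\rangle\langle1|=1_0$; (CNT.7) $(|1\rangle\otimes|1\rangle\otimes1_1)C_{1\to2}C_{2\to3}(\langle1|\otimes1_2)=(|1\rangle\otimes|1\rangle\otimes1_1)C_{1\to2}(\langle1|\otimes1_2)$ and $(|1\rangle\otimes1_2)C_{2\to3}C_{1\to2}(\langle1|\otimes\langle1|\otimes1_1)=(|1\rangle\otimes1_2)C_{1\to2}(\langle1|\otimes\langle1|\otimes1_1)$; (CNT.8) $C_{1\to2}C_{2\to3}C_{1\to2}=C_{2\to3}C_{1\to3}$; (CNT.9) $(|1\rangle\otimes|1\rangle\otimes1_1)C_{1\to2}(\langle1|\otimes\langle1|\otimes1_1)=(|1\rangle\otimes|1\rangle\otimes\langle1|)C_{1\to2}(\langle1|\otimes\langle1|\otimes|1\rangle)$. The horizontal flip $(-)^\circ:\mathsf{CNOT}^{op}\to\mathsf{CNOT}$ is the identity-on-objects monoidal functor fixing $\mathsf{cnot},\sigma$ and exchanging $|1\rangle,\langle1|$; the restriction is $\overline f=ff^\circ$, and $e$ is a restriction idempotent if $e=\overline e$. $\mathsf{CTor}_2$: finitely generated commutative torsors of characteristic 2 (sets with ternary operation $a\times_b c$ satisfying para-associativity $(a\times_b c)\times_d e=a\times_{d\times_c b}e=a\times_b(c\times_d e)$, para-identity $a\times_b b=b\times_b a=a$, commutativity $a\times_b c=c\times_b a$, $a\times_b a=b$), with homomorphisms. $\mathsf{ParIso}(\mathsf{CTor}_2)^*$: partial isomorphisms (spans $A\xleftarrow{m}A'\xrightarrow{f}B$,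 $m$ monic, modulo iso, with partial inverse) between nonempty such torsors, with restriction $\overline{(m,f)}=(m,m)$. $\tilde H_0$ is the symmetric monoidal functor sending $n$ to $\mathbb{Z}_2^n$ with $a\times_b c=a\oplus b\oplus c$ (tensor being cartesian product), $\mathsf{cnot}$ to $(x,y)\mapsto(x,x\oplus y)$, $\sigma$ to the swap, $|1\rangle$ to the total map $\mathbb{Z}_2^0\to\mathbb{Z}_2$ with value $1$, and $\langle1|$ to the partial map $\mathbb{Z}_2\to\mathbb{Z}_2^0$ defined exactly on $1$. (Equivalently, $\tilde H_0(n)$ is the set of total maps $0\to n$ in $\mathsf{CNOT}$ and $\tilde H_0(f)$ sends a total $g:0\to n$ to $gf$ when $gf$ is total, undefined otherwise.) *)

(* Defs.v *)
From Stdlib Require Import List Setoid Morphisms.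
From mathcomp Require Import all_boot all_algebra boolp.

Set Implicit Arguments.
Unset Strict Implicit.
Unset Printing Implicit Defensive.

Import GRing.Theory.

(* Terms denoting the arrows of CNOT; the arrows themselves are the terms
   modulo [ceq] below. *)
Inductive circ : nat -> nat -> Type :=
| idc n : circ n n
| ccomp n m k : circ n m -> circ m k -> circ n k
| ctens n m n' m' : circ n m -> circ n' m' -> circ (n + n') (m + m')
| csym m n : circ (m + n) (n + m)
| cnot : circ 2 2
| ket1 : circ 0 1
| bra1 : circ 1 0.

Declare Scope circ_scope.
Delimit Scope circ_scope with circ.
Bind Scope circ_scope with circ.

Notation "f ;; g" := (ccomp f g)
  (at level 50, left associativity) : circ_scope.
Notation "f ⊗ g" := (ctens f g)
  (at level 40, left associativity) : circ_scope.

(* The tensor is strictly associative and unital on objects only up to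
   provable equality of natural numbers. *)
Definition castc n m n' m' (en : n = n') (em : m = m') (f : circ n m) :
  circ n' m' :=
  let: erefl := en in let: erefl := em in f.

Definition swap : circ 2 2 := csym 1 1.

(* [Cg_ij] is the cnot gate on g wires with control i and target j. *)
Definition C2_12 : circ 2 2 := cnot.
Definition C2_21 : circ 2 2 := (swap ;; C2_12 ;; swap)%circ.
Definition C3_12 : circ 3 3 := (C2_12 ⊗ idc 1)%circ.
Definition C3_21 : circ 3 3 := (C2_21 ⊗ idc 1)%circ.
Definition C3_23 : circ 3 3 := (idc 1 ⊗ C2_12)%circ.
Definition C3_32 : circ 3 3 := (idc 1 ⊗ C2_21)%circ.
Definition C3_13 : circ 3 3 := ((idc 1 ⊗ swap) ;; C3_12 ;; (idc 1 ⊗ swap))%circ.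

Reserved Notation "f ≡ g" (at level 70, no associativity).

Inductive ceq : forall n m, circ n m -> circ n m -> Prop :=
| ceq_refl n m (f : circ n m) : f ≡ f
| ceq_sym n m (f g : circ n m) : f ≡ g -> g ≡ f
| ceq_trans n m (f g h : circ n m) : f ≡ g -> g ≡ h -> f ≡ h
| ceq_comp n m k (f f' : circ n m) (g g' : circ m k) :
    f ≡ f' -> g ≡ g' -> f ;; g ≡ f' ;; g'
| ceq_tens n m n' m' (f f' : circ n m) (g g' : circ n' m') :
    f ≡ f' -> g ≡ g' -> f ⊗ g ≡ f' ⊗ g'
| ceq_compA n m k l (f : circ n m) (g : circ m k) (h : circ k l) :
    f ;; (g ;; h) ≡ f ;; g ;; h
| ceq_idl n m (f : circ n m) : idc n ;; f ≡ f
| ceq_idr n m (f : circ n m) : f ;; idc m ≡ f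
| ceq_tens_id n m : idc n ⊗ idc m ≡ idc (n + m)
| ceq_interchange n m k n' m' k'
    (f : circ n m) (g : circ m k) (f' : circ n' m') (g' : circ m' k') :
    (f ;; g) ⊗ (f' ;; g') ≡ (f ⊗ f') ;; (g ⊗ g')
| ceq_tensA n m n' m' n'' m''
    (f : circ n m) (g : circ n' m') (h : circ n'' m'') :
    castc (addnA _ _ _) (addnA _ _ _) (f ⊗ (g ⊗ h)) ≡ f ⊗ g ⊗ h
| ceq_tens0l n m (f : circ n m) :
    castc (add0n _) (add0n _) (idc 0 ⊗ f) ≡ f
| ceq_tens0r n m (f : circ n m) :
    castc (addn0 _) (addn0 _) (f ⊗ idc 0) ≡ f
| ceq_sym_nat n m n' m' (f : circ n m) (g : circ n' m') :
    (f ⊗ g) ;; csym m m' ≡ csym n n' ;; (g ⊗ f)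
| ceq_symK m n : csym m n ;; csym n m ≡ idc (m + n)
| ceq_hexagon m n p :
    csym m (n + p) ≡
      castc (esym (addnA m n p)) (esym (addnA n m p)) (csym m n ⊗ idc p) ;;
      castc erefl (addnA n p m) (idc n ⊗ csym m p)
| CNT1 : C2_12 ;; C2_21 ;; C2_12 ≡ swap
| CNT2 : C2_12 ;; C2_12 ≡ idc 2
| CNT3 : C3_21 ;; C3_23 ≡ C3_23 ;; C3_21
| CNT4_ket :
    (ket1 ⊗ idc 1) ;; C2_12 ≡
    (ket1 ⊗ idc 1) ;; C2_12 ;; (bra1 ⊗ idc 1) ;; (ket1 ⊗ idc 1)
| CNT4_bra :
    C2_12 ;; (bra1 ⊗ idc 1) ≡
    (bra1 ⊗ idc 1) ;; (ket1 ⊗ idc 1) ;; C2_12 ;; (bra1 ⊗ idc 1)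
| CNT5 : C3_12 ;; C3_32 ≡ C3_32 ;; C3_12
| CNT6 : ket1 ;; bra1 ≡ idc 0
| CNT7_ket :
    (ket1 ⊗ ket1 ⊗ idc 1) ;; C3_12 ;; C3_23 ;; (bra1 ⊗ idc 2) ≡
    (ket1 ⊗ ket1 ⊗ idc 1) ;; C3_12 ;; (bra1 ⊗ idc 2)
| CNT7_bra :
    (ket1 ⊗ idc 2) ;; C3_23 ;; C3_12 ;; (bra1 ⊗ bra1 ⊗ idc 1) ≡
    (ket1 ⊗ idc 2) ;; C3_12 ;; (bra1 ⊗ bra1 ⊗ idc 1)
| CNT8 : C3_12 ;; C3_23 ;; C3_12 ≡ C3_23 ;; C3_13
| CNT9 :
    (ket1 ⊗ ket1 ⊗ idc 1) ;; C3_12 ;; (bra1 ⊗ bra1 ⊗ idc 1) ≡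
    (ket1 ⊗ ket1 ⊗ bra1) ;; C2_12 ;; (bra1 ⊗ bra1 ⊗ ket1)
where "f ≡ g" := (ceq f%circ g%circ).

Fixpoint cflip n m (f : circ n m) : circ m n :=
  match f with
  | idc n => idc n
  | ccomp _ _ _ f g => ccomp (cflip g) (cflip f)
  | ctens _ _ _ _ f g => ctens (cflip f) (cflip g)
  | csym m n => csym n m
  | cnot => cnot
  | ket1 => bra1
  | bra1 => ket1
  end.

Definition crst n m (f : circ n m) : circ n n := ccomp f (cflip f).

Definition crest_idem n (e : circ n n) : Prop := e ≡ crst e.

#[export] Hint Resolve ceq_refl : core.

#[export] Instance ceq_equiv n m : Equivalence (@ceq n m).
Proof.
split; [exact: ceq_refl|exact: ceq_sym|exact: ceq_trans].
Qed.

#[export] Instance ccomp_ceq n m k :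
  Proper (@ceq n m ==> @ceq m k ==> @ceq n k) (@ccomp n m k).
Proof. by move=> f f' ff' g g' gg'; exact: ceq_comp. Qed.

#[export] Instance ctens_ceq n m n' m' :
  Proper (@ceq n m ==> @ceq n' m' ==> @ceq (n + n') (m + m')) (@ctens n m n' m').
Proof. by move=> f f' ff' g g' gg'; exact: ceq_tens. Qed.

Lemma cflip_castc n m n' m' (en : n = n') (em : m = m') (f : circ n m) :
  cflip (castc en em f) = castc em en (cflip f).
Proof. by case: n' / en; case: m' / em. Qed.

Lemma cflipK n m (f : circ n m) : cflip (cflip f) = f.
Proof. by elim: f => //= [n' m' k f -> g ->|n1 m1 n2 m2 f -> g ->]. Qed.

Lemma castc_inv n m n' m' (en : n = n') (em : m = m') (f : circ n m)
    (g : circ m n) :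
  f ;; g ≡ idc n -> castc en em f ;; castc em en g ≡ idc n'.
Proof. by case: n' / en; case: m' / em. Qed.

Lemma ceq_tens_idc_inv n m p (f : circ n m) (g : circ m n) :
  f ;; g ≡ idc n -> (f ⊗ idc p) ;; (g ⊗ idc p) ≡ idc (n + p).
Proof. by move=> fg; rewrite -ceq_interchange fg ceq_idl ceq_tens_id. Qed.

Lemma ceq_idc_tens_inv n m p (f : circ n m) (g : circ m n) :
  f ;; g ≡ idc n -> (idc p ⊗ f) ;; (idc p ⊗ g) ≡ idc (p + n).
Proof. by move=> fg; rewrite -ceq_interchange fg ceq_idl ceq_tens_id. Qed.

Lemma ceq_inv_comp n m k (f : circ n m) (f' : circ m n)
    (g : circ m k) (g' : circ k m) :
  f ;; f' ≡ idc n -> g ;; g' ≡ idc m -> f ;; g ;; (g' ;; f') ≡ idc n.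
Proof.
move=> ff gg; rewrite ceq_compA -(ceq_compA f g) gg ceq_idr ff; reflexivity.
Qed.

Lemma ceq_inv_uniq n m (f : circ n m) (g h : circ m n) :
  g ;; f ≡ idc m -> f ;; h ≡ idc n -> g ≡ h.
Proof.
by move=> gf fh; rewrite -(ceq_idr g) -fh ceq_compA gf ceq_idl.
Qed.

Lemma cnot_gate_inv :
  [/\ C2_21 ;; C2_21 ≡ idc 2, C3_12 ;; C3_12 ≡ idc 3, C3_23 ;; C3_23 ≡ idc 3
   & C3_13 ;; C3_13 ≡ idc 3].
Proof.
have s2 : swap ;; swap ≡ idc 2 := ceq_symK 1 1.
have conj n (a f : circ n n) : a ;; a ≡ idc n -> f ;; f ≡ idc n ->
    a ;; f ;; a ;; (a ;; f ;; a) ≡ idc n.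
  by move=> aa ff; rewrite !ceq_compA -(ceq_compA (a ;; f)%circ a a) aa ceq_idr
    -(ceq_compA a f f) ff ceq_idr aa.
have c12 : C3_12 ;; C3_12 ≡ idc 3 by exact: (ceq_tens_idc_inv 1 CNT2).
split=> //.
- exact: conj s2 CNT2.
- exact: (ceq_idc_tens_inv 1 CNT2).
- by apply: conj c12; exact: (ceq_idc_tens_inv 1 s2).
Qed.

Lemma cflip_hexagon m n p :
  cflip (csym m (n + p)) ≡ cflip (
    castc (esym (addnA m n p)) (esym (addnA n m p)) (csym m n ⊗ idc p) ;;
    castc erefl (addnA n p m) (idc n ⊗ csym m p)).
Proof.
apply: (ceq_inv_uniq (ceq_symK _ _)); rewrite {1}ceq_hexagon.
set A := castc _ _ (csym m n ⊗ idc p); set B := castc _ _ (_ ⊗ csym m p).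
refine (ceq_inv_comp (f := A) (f' := cflip A) (g := B) (g' := cflip B) _ _).
- rewrite cflip_castc; apply: castc_inv; apply: ceq_tens_idc_inv.
  exact: ceq_symK.
- rewrite cflip_castc; apply: castc_inv; apply: ceq_idc_tens_inv.
  exact: ceq_symK.
Qed.

Lemma cflip_comp n m k (f : circ n m) (g : circ m k) :
  cflip (f ;; g)%circ = (cflip g ;; cflip f)%circ.
Proof. by []. Qed.

Lemma cflip_C2_21 : cflip C2_21 ≡ C2_21.
Proof. exact: ceq_compA. Qed.

Lemma cflip_C3_21 : cflip C3_21 ≡ C3_21.
Proof. exact (ceq_tens cflip_C2_21 (ceq_refl (idc 1))). Qed.

Lemma cflip_C3_32 : cflip C3_32 ≡ C3_32.
Proof. exact (ceq_tens (ceq_refl (idc 1)) cflip_C2_21). Qed.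

Lemma cflip_C3_13 : cflip C3_13 ≡ C3_13.
Proof. exact: ceq_compA. Qed.

Lemma cflip_CNT8 : cflip (C3_12 ;; C3_23 ;; C3_12) ≡ cflip (C3_23 ;; C3_13).
Proof.
have [_ c12 c23 c13] := cnot_gate_inv.
change (C3_12 ;; (C3_23 ;; C3_12) ≡ cflip C3_13 ;; C3_23).
rewrite cflip_C3_13 ceq_compA.
apply: (ceq_inv_uniq (f := (C3_12 ;; C3_23 ;; C3_12)%circ)).
- rewrite !ceq_compA -(ceq_compA _ C3_12 C3_12) c12 ceq_idr.
  by rewrite -(ceq_compA _ C3_23 C3_23) c23 ceq_idr.
- by rewrite CNT8; exact: ceq_inv_comp.
Qed.

Theorem cflip_ceq n m (f g : circ n m) : f ≡ g -> cflip f ≡ cflip g.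
Proof.
elim=> {n m f g}.
- by [].
- by move=> n m f g _ ->.
- by move=> n m f g h _ -> _ ->.
- by move=> n m k f f' g g' _ /= -> _ ->.
- by move=> n m n' m' f f' g g' _ /= -> _ ->.
- by move=> * /=; rewrite ceq_compA.
- by move=> * /=; rewrite ceq_idr.
- by move=> * /=; rewrite ceq_idl.
- by move=> * /=; rewrite ceq_tens_id.
- by move=> * /=; rewrite ceq_interchange.
- by move=> *; rewrite cflip_castc /= ceq_tensA.
- by move=> *; rewrite cflip_castc /= ceq_tens0l.
- by move=> *; rewrite cflip_castc /= ceq_tens0r.
- by move=> * /=; rewrite ceq_sym_nat.
- by move=> * /=; rewrite ceq_symK.
- exact: cflip_hexagon.
- change (C2_12 ;; (cflip C2_21 ;; C2_12) ≡ swap).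
  by rewrite cflip_C2_21 ceq_compA; exact: CNT1.
- exact: CNT2.
- change (C3_23 ;; cflip C3_21 ≡ cflip C3_21 ;; C3_23).
  by rewrite cflip_C3_21; symmetry; exact: CNT3.
- by rewrite !cflip_comp !ceq_compA; exact: CNT4_bra.
- by rewrite !cflip_comp !ceq_compA; exact: CNT4_ket.
- change (cflip C3_32 ;; C3_12 ≡ C3_12 ;; cflip C3_32).
  by rewrite cflip_C3_32; symmetry; exact: CNT5.
- exact: CNT6.
- by rewrite !cflip_comp !ceq_compA; exact: CNT7_bra.
- by rewrite !cflip_comp !ceq_compA; exact: CNT7_ket.
- exact: cflip_CNT8.
- by rewrite !cflip_comp !ceq_compA; exact: CNT9.
Qed.

(* [tor a b c] is a ×_b c. *)
Record torsor := Torsor {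
  torsor_car :> Type;
  tor : torsor_car -> torsor_car -> torsor_car -> torsor_car;
  tor_assocl : forall a b c d e, tor (tor a b c) d e = tor a (tor d c b) e;
  tor_assocr : forall a b c d e, tor a (tor d c b) e = tor a b (tor c d e);
  tor_idr : forall a b, tor a b b = a;
  tor_idl : forall a b, tor b b a = a;
  torC : forall a b c, tor a b c = tor c b a;
  tor_char2 : forall a b, tor a b a = b }.

Definition subtorsor (A : torsor) (P : A -> Prop) : Prop :=
  forall a b c, P a -> P b -> P c -> P (tor a b c).

Definition finitely_generated (A : torsor) : Prop :=
  exists s : seq A, forall P : A -> Prop,
    subtorsor P -> (forall x, In x s -> P x) -> forall x, P x.

(* The empty torsor is allowed here. *)
Record ctor2 := Ctor2 {
  ctor2_torsor :> torsor;
  ctor2_fg : finitely_generated ctor2_torsor }.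

Record thom (A B : ctor2) := Thom {
  thom_fun :> A -> B;
  thomP : forall a b c,
    thom_fun (tor a b c) = tor (thom_fun a) (thom_fun b) (thom_fun c) }.

Definition monic (A B : ctor2) (m : thom A B) : Prop :=
  forall (Z : ctor2) (g h : thom Z A), m \o g =1 m \o h -> g =1 h.

Lemma fg_finite (A : torsor) :
  finitely_generated A -> exists s : seq A, forall x, In x s.
Proof.
case=> -[|a s] sP.
  by exists [::]; refine (sP (fun=> False) _ _) => [a b c []|x []].
pose add x y := tor x a y.
have addA x y z : add (add x y) z = add x (add y z).
  by rewrite /add tor_assocl tor_assocr.
have addC x y : add x y = add y x by rewrite /add torC.
have addxx x : add x x = a by rewrite /add tor_char2.
have add0 x : add a x = x by rewrite /add tor_idl.
have torE x y z : tor x y z = add (add x y) z.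
  by rewrite /add tor_assocl tor_char2.
pose L := foldr (fun x l => app l (List.map (add x) l)) [:: a].
have inL x t y : In y (L (x :: t)) <->
    In y (L t) \/ exists2 z, In z (L t) & y = add x z.
  rewrite /= in_app_iff in_map_iff; split=> -[|[z]]; try by left.
  - by case=> <- zt; right; exists z.
  - by move=> zt ->; right; exists z.
have aL t : In a (L t) by elim: t => [|x t IH]; [left|apply/inL; left].
have addL t y z : In y (L t) -> In z (L t) -> In (add y z) (L t).
  elim: t y z => [|x t IH] y z.
    by move=> /= [<-|//] [<-|//]; left; rewrite add0.
  move=> /inL[yt|[y' yt ->]] /inL[zt|[z' zt ->]]; apply/inL.
  - by left; exact: IH.
  - right; exists (add y z'); first exact: IH.
    by rewrite -!addA (addC y).
  - by right; exists (add y' z); [exact: IH|rewrite addA].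
  - left; rewrite addA (addC y') addA -addA addxx add0 addC; exact: IH.
exists (L s); apply: (sP (fun x => In x (L s))) => [x y z xL yL zL|x].
  by rewrite torE; apply: (addL) => //; exact: addL.
case=> [<-|]; first exact: aL.
elim: s {sP} => //= y s IH [<-|/IH xs]; apply/(inL y s); last by left.
by right; exists a => //; rewrite addC add0.
Qed.

Lemma finite_fg (A : torsor) :
  (exists s : seq A, forall x, In x s) -> finitely_generated A.
Proof. by move=> [s sP]; exists s => P _ Ps x; exact: Ps. Qed.

Lemma ctor2_finite (A : ctor2) : exists s : seq A, forall x, In x s.
Proof. by case: A => A fgA; exact: fg_finite. Qed.

Definition torsor_prod (A B : torsor) : torsor.
Proof.
exists (A * B)%type
  (fun a b c => (tor a.1 b.1 c.1, tor a.2 b.2 c.2)).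
- by move=> a b c d e /=; rewrite !tor_assocl.
- by move=> a b c d e /=; rewrite !tor_assocr.
- by case=> a a' b /=; rewrite !tor_idr.
- by case=> a a' b /=; rewrite !tor_idl.
- by move=> a b c /=; rewrite torC [tor a.2 _ _]torC.
- by move=> a [b b'] /=; rewrite !tor_char2.
Defined.

Definition ctor2_prod (A B : ctor2) : ctor2.
Proof.
exists (torsor_prod A B).
apply: finite_fg; have [s sP] := ctor2_finite A; have [t tP] := ctor2_finite B.
exists (list_prod s t) => -[x y]; apply/in_prod_iff; split; [exact: sP|exact: tP].
Defined.


Lemma sval_inj (T : Type) (P : T -> Prop) : injective (@sval T P).
Proof. by move=> [x px] [y py] /= xy; exact: eq_exist. Qed.

Definition torsor_sub (A : torsor) (P : A -> Prop) (PA : subtorsor P) : torsor.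
Proof.
exists {x : A | P x} (fun a b c => exist P (tor (sval a) (sval b) (sval c))
    (PA _ _ _ (svalP a) (svalP b) (svalP c))).
- by move=> a b c d e; apply: sval_inj; rewrite /= tor_assocl.
- by move=> a b c d e; apply: sval_inj; rewrite /= tor_assocr.
- by move=> a b; apply: sval_inj; rewrite /= tor_idr.
- by move=> a b; apply: sval_inj; rewrite /= tor_idl.
- by move=> a b c; apply: sval_inj; rewrite /= torC.
- by move=> a b; apply: sval_inj; rewrite /= tor_char2.
Defined.

Definition ctor2_sub (A : ctor2) (P : A -> Prop) (PA : subtorsor P) : ctor2.
Proof.
exists (torsor_sub PA); apply: finite_fg; have [s sP] := ctor2_finite A.
pose f x : seq (torsor_sub PA) :=
  if pselect (P x) is left Px then [:: exist P x Px] else [::].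
exists (flat_map f s) => -[x Px]; apply/in_flat_map; exists x; split => //.
by rewrite /f; case: pselect => //= Px'; left; exact: eq_exist.
Defined.

Lemma pullback_subtorsor (A B C : ctor2) (f : thom A C) (g : thom B C) :
  subtorsor (fun p : ctor2_prod A B => f p.1 = g p.2).
Proof. by move=> a b c /= ea eb ec; rewrite !thomP ea eb ec. Qed.

Definition pullback (A B C : ctor2) (f : thom A C) (g : thom B C) : ctor2 :=
  ctor2_sub (@pullback_subtorsor A B C f g).

Definition thom_id (A : ctor2) : thom A A := @Thom A A id (fun _ _ _ => erefl).

Definition thom_comp (A B C : ctor2) (g : thom B C) (f : thom A B) : thom A C.
Proof. by exists (g \o f) => a b c; rewrite /= !thomP. Defined.

Definition pullback_fst (A B C : ctor2) (f : thom A C) (g : thom B C) :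
  thom (pullback f g) A := @Thom (pullback f g) A (fun p => (sval p).1)
    (fun _ _ _ => erefl).

Definition pullback_snd (A B C : ctor2) (f : thom A C) (g : thom B C) :
  thom (pullback f g) B := @Thom (pullback f g) B (fun p => (sval p).2)
    (fun _ _ _ => erefl).

Definition pullback_diag (A C : ctor2) (f : thom A C) : thom A (pullback f f).
Proof.
exists (fun x => exist (fun p : A * A => f p.1 = f p.2) (x, x) erefl) => a b c.
exact: sval_inj.
Defined.

Definition ctor2_unit : ctor2.
Proof.
exists (@Torsor unit (fun _ _ _ => tt) (fun _ _ _ _ _ => erefl)
   (fun _ _ _ _ _ => erefl) (fun a _ => let: tt := a in erefl)
   (fun a _ => let: tt := a in erefl) (fun _ _ _ => erefl)
   (fun _ b => let: tt := b in erefl)).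
by apply: finite_fg; exists [:: tt] => -[]; left.
Defined.

Lemma monicP (A B : ctor2) (m : thom A B) : monic m <-> injective m.
Proof.
split=> [mm x y mxy|im Z g h mgh z]; last exact/im/mgh.
pose cst z : thom ctor2_unit A :=
  @Thom ctor2_unit A (fun=> z) (fun _ _ _ => esym (tor_idr _ _)).
by apply: (mm _ (cst x) (cst y) _ tt) => -[].
Qed.

Record span (A B : ctor2) := Span {
  apex : ctor2;
  legl : thom apex A;
  legr : thom apex B;
  legl_monic : monic legl }.

(* Spans are identified up to isomorphism. *)
Definition span_eq (A B : ctor2) (S T : span A B) : Prop :=
  exists (phi : thom (apex S) (apex T)) (psi : thom (apex T) (apex S)),
    [/\ cancel phi psi, cancel psi phi,
        legl T \o phi =1 legl S & legr T \o phi =1 legr S].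

Lemma span_comp_monic (A B C : ctor2) (S : span A B) (T : span B C) :
  monic (thom_comp (legl S) (pullback_fst (legr S) (legl T))).
Proof.
have /monicP iS := @legl_monic _ _ S; have /monicP iT := @legl_monic _ _ T.
apply/monicP => -[[a b] /= ab] [[a' b'] /= ab'] /= /iS aa'; apply: eq_exist.
by congr pair => //; apply: iT; rewrite -ab -ab' aa'.
Qed.

(* Diagrammatic order. *)
Definition span_comp (A B C : ctor2) (S : span A B) (T : span B C) : span A C :=
  Span (thom_comp (legr T) (pullback_snd (legr S) (legl T)))
       (@span_comp_monic A B C S T).

Definition span_rst (A B : ctor2) (S : span A B) : span A A :=
  Span (legl S) (@legl_monic A B S).

Definition partial_iso (A B : ctor2) (S : span A B) : Prop :=
  exists T : span B A,
    span_eq (span_comp S T) (span_rst S) /\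
    span_eq (span_comp T S) (span_rst T).

Lemma partial_isoP (A B : ctor2) (S : span A B) :
  partial_iso S <-> injective (legr S).
Proof.
have iS : injective (legl S) by apply/monicP; exact: legl_monic.
split=> [[T [[phi [psi [phiK psiK /= el er]]] _]] x y Sxy|ir].
  have iT : injective (legl T) by apply/monicP; exact: legl_monic.
  have key z : exists2 t, legr S z = legl T t & legl S z = legr T t.
    rewrite -[z]psiK; case: (psi z) => -[z' t] /= zt.
    exists t; last by rewrite -[RHS](er (exist _ (z', t) zt)).
    rewrite -zt; congr (legr _ _); apply: iS.
    exact: (el (exist _ (z', t) zt)).
  have [t xt xt'] := key x; have [u yu yu'] := key y.
  by apply: iS; rewrite xt' yu'; congr (legr _ _); apply: iT; rewrite -xt -yu.
have mr : monic (legr S) by apply/monicP.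
exists (Span (legl S) mr); split.
- exists (pullback_fst (legr S) (legr S)), (pullback_diag (legr S)).
  split=> //.
  + by move=> [[x y] xy]; apply: sval_inj; congr pair; exact: ir.
  + by move=> [[x y] xy] /=; congr (legl _ _); exact: ir.
- exists (pullback_fst (legl S) (legl S)), (pullback_diag (legl S)).
  split=> //.
  + by move=> [[x y] xy]; apply: sval_inj; congr pair; exact: iS.
  + by move=> [[x y] xy] /=; congr (legr _ _); exact: iS.
Qed.

Record ctor2_ne := Ctor2_ne {
  ctor2_ne_car :> ctor2;
  ctor2_neP : inhabited ctor2_ne_car }.

(* The arrows of ParIso(CTor_2)^*, up to [pariso_eq]. *)
Record pariso (A B : ctor2_ne) := Pariso {
  pariso_span :> span A B;
  parisoP : partial_iso pariso_span }.

Definition pariso_eq (A B : ctor2_ne) (S T : pariso A B) : Prop := span_eq S T.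

Definition pariso_of (X : ctor2) (A B : ctor2_ne) (m : thom X A) (f : thom X B)
    (im : injective m) (jf : injective f) : pariso A B.
Proof.
apply: (@Pariso A B (Span f (iffRL (monicP m) im))).
by apply/partial_isoP.
Defined.

Definition pariso_id (A : ctor2_ne) : pariso A A :=
  @pariso_of A A A (thom_id A) (thom_id A) (@inj_id _) (@inj_id _).

Definition pariso_comp (A B C : ctor2_ne) (S : pariso A B) (T : pariso B C) :
  pariso A C.
Proof.
exists (span_comp S T); apply/partial_isoP => -[[a b] ab] [[a' b'] ab'] /= e.
have iS := (iffLR (partial_isoP S) (parisoP S)).
have iT := (iffLR (partial_isoP T) (parisoP T)).
have eb := iT _ _ e; apply: sval_inj; congr pair; last exact: eb.
by apply: iS; move: ab ab' => /= -> ->; rewrite eb.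
Defined.

Definition pariso_rst (A B : ctor2_ne) (S : pariso A B) : pariso A A.
Proof.
exists (span_rst S); apply/partial_isoP/monicP; exact: legl_monic.
Defined.

Definition pariso_rest_idem (A : ctor2_ne) (E : pariso A A) : Prop :=
  pariso_eq E (pariso_rst E).

Local Open Scope ring_scope.

Lemma addrr_F2 (V : lmodType 'F_2) (x : V) : x + x = 0.
Proof.
rewrite -mulr2n -scaler_nat (_ : 2%:R = 0 :> 'F_2) ?scale0r //; exact/val_inj.
Qed.

Definition Z2_torsor (n : nat) : torsor.
Proof.
exists 'rV['F_2]_n (fun a b c => a + b + c).
- by move=> a b c d e; rewrite (addrC (d + c) b) (addrC d c) !addrA.
- by move=> a b c d e; rewrite (addrC (d + c) b) (addrC d c) !addrA.
- by move=> a b; rewrite -addrA addrr_F2 addr0.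
- by move=> a b; rewrite addrr_F2 add0r.
- by move=> a b c; rewrite addrC [a + b]addrC addrA.
- by move=> a b; rewrite addrAC addrr_F2 add0r.
Defined.

Definition Z2_ctor2 (n : nat) : ctor2.
Proof.
exists (Z2_torsor n); apply: finite_fg; exists (enum 'rV['F_2]_n) => x.
by have := mem_enum 'rV['F_2]_n x; elim: (enum _) => //= y s IH;
  rewrite !inE => /orP[/eqP->|/IH]; [left|right].
Defined.

Definition Z2 (n : nat) : ctor2_ne :=
  @Ctor2_ne (Z2_ctor2 n) (inhabits (0 : 'rV['F_2]_n)).

Definition thom_prod (A B A' B' : ctor2) (f : thom A B) (f' : thom A' B') :
  thom (ctor2_prod A A') (ctor2_prod B B').
Proof. by exists (fun x => (f x.1, f' x.2)) => a b c; rewrite /= !thomP. Defined.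

Definition Z2_row (n m : nat) : thom (ctor2_prod (Z2 n) (Z2 m)) (Z2 (n + m)).
Proof.
by exists (fun x => row_mx x.1 x.2) => a b c; rewrite /= !add_row_mx.
Defined.

Lemma thom_prod_row_inj (A A' : ctor2) (n m : nat)
    (f : thom A (Z2 n)) (f' : thom A' (Z2 m)) :
  injective f -> injective f' ->
  injective (thom_comp (Z2_row n m) (thom_prod f f')).
Proof.
by move=> If If' [x x'] [y y'] /= /eq_row_mx[/If-> /If'->].
Qed.

(* The product of two partial isomorphisms, transported along the isomorphisms
   [Z2_row] between Z_2^n x Z_2^m and Z_2^(n + m). *)
Definition pariso_tens (n m n' m' : nat)
    (S : pariso (Z2 n) (Z2 m)) (S' : pariso (Z2 n') (Z2 m')) :
    pariso (Z2 (n + n')) (Z2 (m + m')).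
Proof.
apply: (@pariso_of (ctor2_prod (apex S) (apex S')) _ _
  (thom_comp (Z2_row n n') (thom_prod (legl S) (legl S')))
  (thom_comp (Z2_row m m') (thom_prod (legr S) (legr S')))).
- by apply: thom_prod_row_inj; apply/monicP; exact: legl_monic.
- by apply: thom_prod_row_inj; apply/partial_isoP; exact: parisoP.
Defined.

Definition Z2_swap (m n : nat) : thom (Z2 (m + n)) (Z2 (n + m)).
Proof.
exists (fun x : 'rV['F_2]_(m + n) => row_mx (rsubmx x) (lsubmx x)).
by move=> a b c; rewrite /= !linearD !add_row_mx.
Defined.

Lemma Z2_swap_inj m n : injective (Z2_swap m n).
Proof.
by move=> x y /= /eq_row_mx[er el]; rewrite -[x]hsubmxK -[y]hsubmxK el er.
Qed.

Definition cnot_fun (x : 'rV['F_2]_(1 + 1)) : 'rV['F_2]_(1 + 1) :=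
  row_mx (lsubmx x) (lsubmx x + rsubmx x).

Lemma cnot_funD x y : cnot_fun (x + y) = cnot_fun x + cnot_fun y.
Proof. by rewrite /cnot_fun !linearD add_row_mx addrACA. Qed.

Definition Z2_cnot : thom (Z2 2) (Z2 2).
Proof.
exists cnot_fun => a b c.
exact: etrans (cnot_funD _ _) (congr1 (+%R^~ _) (cnot_funD _ _)).
Defined.

Lemma Z2_cnot_inj : injective Z2_cnot.
Proof.
suff: injective cnot_fun by [].
move=> x y /eq_row_mx[el]; rewrite el => /addrI er.
by rewrite -[x]hsubmxK -[y]hsubmxK el er.
Qed.

Definition Z2_one : thom (Z2 0) (Z2 1).
Proof.
exists (fun=> const_mx 1) => a b c.
by rewrite /= addrr_F2 add0r.
Defined.

Lemma Z2_one_inj : injective Z2_one.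
Proof. by move=> x y _; rewrite [x]thinmx0 [y]thinmx0. Qed.

Fixpoint H0 n m (f : circ n m) : pariso (Z2 n) (Z2 m) :=
  match f with
  | idc n => pariso_id (Z2 n)
  | ccomp _ _ _ f g => pariso_comp (H0 f) (H0 g)
  | ctens _ _ _ _ f g => pariso_tens (H0 f) (H0 g)
  | csym m n => pariso_of (@inj_id _ : injective (thom_id _)) (@Z2_swap_inj m n)
  | cnot => pariso_of (@inj_id _ : injective (thom_id _)) Z2_cnot_inj
  | ket1 => pariso_of (@inj_id _ : injective (thom_id _)) Z2_one_inj
  | bra1 => pariso_of Z2_one_inj (@inj_id _ : injective (thom_id _))
  end.

Definition span_rel (A B : ctor2) (S : span A B) (x : A) (y : B) : Prop :=
  exists2 a, legl S a = x & legr S a = y.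

Lemma span_eqP (A B : ctor2) (S T : span A B) :
  span_eq S T <-> forall x y, span_rel S x y <-> span_rel T x y.
Proof.
have /monicP iS := @legl_monic _ _ S; have /monicP iT := @legl_monic _ _ T.
split=> [[phi [psi [phiK psiK el er]]] x y|ST].
  split=> -[a <- <-]; first by exists (phi a); [exact: el|exact: er].
  by exists (psi a); rewrite -?el -?er /= psiK.
have fwd (U V : span A B) : (forall x y, span_rel U x y -> span_rel V x y) ->
    {f : thom (apex U) (apex V) |
      legl V \o f =1 legl U /\ legr V \o f =1 legr U}.
  move=> UV; have ex u : exists v, legl V v = legl U u /\ legr V v = legr U u.
    by have [|v vl vr] := UV (legl U u) (legr U u); [exists u|exists v].
  pose f u := sval (boolp.cid (ex u)).
  have fP u := svalP (boolp.cid (ex u)).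
  have fhom a b c : f (tor a b c) = tor (f a) (f b) (f c).
    have /monicP iV := @legl_monic _ _ V; apply: iV.
    by rewrite (fP _).1 !thomP !(fP _).1.
  by exists (Thom fhom); split=> u /=; [exact: (fP u).1|exact: (fP u).2].
have [phi [pl pr]] := fwd S T (fun x y => iffLR (ST x y)).
have [psi [ql qr]] := fwd T S (fun x y => iffRL (ST x y)).
exists phi, psi; split=> // x; [apply: iS|apply: iT].
- exact: etrans (ql _) (pl _).
- exact: etrans (pl _) (ql _).
Qed.

Lemma enum_ordD n m :
  enum 'I_(n + m) = map (@lshift n m) (enum 'I_n) ++ map (@rshift n m) (enum 'I_m).
Proof.
apply: (inj_map val_inj); rewrite val_enum_ord iotaD map_cat.
rewrite -(map_comp val (@lshift n m)) -(map_comp val (@rshift n m)).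
congr (_ ++ _).
  by rewrite -[in LHS](val_enum_ord n); apply: eq_map.
rewrite add0n -[X in iota X m](addn0 n) iotaDl -[in LHS](val_enum_ord m).
rewrite -(map_comp (addn n) val).
exact: eq_map.
Qed.

Definition bits n (x : 'rV['F_2]_n) : seq bool := [seq x 0 i != 0 | i <- enum 'I_n].

Lemma size_bits n (x : 'rV['F_2]_n) : size (bits x) = n.
Proof. by rewrite size_map size_enum_ord. Qed.

Lemma F2_neq0_inj : injective (fun a : 'F_2 => a != 0).
Proof. by case=> [[|[|a]] ia] [[|[|b]] ib] //= _; exact/val_inj. Qed.

Lemma bits_inj n : injective (@bits n).
Proof.
move=> x y /eq_in_map e; apply/rowP => i; apply: F2_neq0_inj.
by apply: e; rewrite mem_enum.
Qed.

Lemma bits_row n m (x : 'rV['F_2]_n) (y : 'rV['F_2]_m) :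
  bits (row_mx x y) = bits x ++ bits y.
Proof.
rewrite /bits enum_ordD map_cat -(map_comp _ (@lshift n m)).
rewrite -(map_comp _ (@rshift n m)); congr (_ ++ _); apply: eq_map => i /=.
- by rewrite row_mxEl.
- by rewrite row_mxEr.
Qed.

(* [H0 f] as a partial function on bit strings; the value is meaningful only on
   strings of length n. *)
Fixpoint sem n m (f : circ n m) (s : seq bool) : option (seq bool) :=
  match f with
  | idc _ => Some s
  | ccomp _ _ _ f g => obind (sem g) (sem f s)
  | ctens n _ _ _ f g =>
      obind (fun u => omap (cat u) (sem g (drop n s))) (sem f (take n s))
  | csym m _ => Some (drop m s ++ take m s)
  | cnot => Some [:: nth false s 0; nth false s 0 (+) nth false s 1]
  | ket1 => Some [:: true]
  | bra1 => if nth false s 0 then Some [::] else None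
  end.


Lemma size_sem n m (f : circ n m) s t :
  size s = n -> sem f s = Some t -> size t = m.
Proof.
elim: f s t => {n m}
  [n|n m k f IHf g IHg|n m n' m' f IHf g IHg|m n|||] s t ss /=.
- by case=> <-.
- by case E: (sem f s) => [u|//] /=; apply: IHg; exact: IHf E.
- case E: (sem f _) => [u|//] /=; case F: (sem g _) => [v|//] /= [<-].
  rewrite size_cat (IHf _ _ _ E) ?(IHg _ _ _ F) //.
    by rewrite size_drop ss addKn.
  by rewrite size_takel // ss leq_addr.
- by case=> <-; rewrite size_cat size_drop size_takel ss ?addKn ?leq_addr.
- by case=> <-.
- by case=> <-.
- by case: nth => // -[<-].
Qed.

Lemma bits_surj n s : size s = n -> exists x : 'rV['F_2]_n, bits x = s.
Proof.
move=> ss; exists (\row_i (nth false s i)%:R).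
apply: (@eq_from_nth _ false); rewrite ?size_bits // => i lti.
rewrite (nth_map (Ordinal lti)) ?size_enum_ord // mxE nth_enum_ord //.
by case: nth.
Qed.

Lemma bits_take n m (x : 'rV['F_2]_(n + m)) : take n (bits x) = bits (lsubmx x).
Proof. by rewrite -{1}[x]hsubmxK bits_row take_size_cat ?size_bits. Qed.

Lemma bits_drop n m (x : 'rV['F_2]_(n + m)) : drop n (bits x) = bits (rsubmx x).
Proof. by rewrite -{1}[x]hsubmxK bits_row drop_size_cat ?size_bits. Qed.

Lemma bits_const1 : bits (const_mx 1 : 'rV['F_2]_1) = [:: true].
Proof. by rewrite /bits enum_ordSl enum_ord0 /= !mxE. Qed.

Lemma bits1 (x : 'rV['F_2]_1) : bits x = [:: x 0 0 != 0].
Proof. by rewrite /bits enum_ordSl enum_ord0. Qed.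

Lemma bits_cnot (x : 'rV['F_2]_(1 + 1)) : bits (cnot_fun x) =
  [:: nth false (bits x) 0; nth false (bits x) 0 (+) nth false (bits x) 1].
Proof.
rewrite -{2 3 4}[x]hsubmxK !bits_row !bits1 /= !mxE.
by move: (x _ _) (x _ (rshift _ _)) => [[|[|a]] ia] [[|[|b]] ib].
Qed.

Lemma bits0 (x : 'rV['F_2]_0) : bits x = [::].
Proof. by apply: size0nil; rewrite size_bits. Qed.

Lemma H0_sem n m (f : circ n m) (x : 'rV['F_2]_n) (y : 'rV['F_2]_m) :
  span_rel (H0 f) x y <-> sem f (bits x) = Some (bits y).
Proof.
elim: f x y => {n m}
  [n|n m k f IHf g IHg|n m n' m' f IHf g IHg|m n|||] x y /=.
- split=> [[a /= <- <- //]|[/bits_inj <-]]; by exists x.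
- split=> [[[[a b] /= ab] <- <-]|].
    have /IHf -> : span_rel (H0 f) (legl (H0 f) a) (legr (H0 f) a) by exists a.
    by apply/IHg; exists b.
  case E: (sem f _) => [u|//] /= gu.
  have [z zu] := bits_surj (size_sem (size_bits _) E).
  have /IHf[a ax az] : sem f (bits x) = Some (bits z) by rewrite zu.
  have /IHg[b bz by_] : sem g (bits z) = Some (bits y) by rewrite zu.
  have ab : legr (H0 f) a = legl (H0 g) b by rewrite az bz.
  by exists (exist _ (a, b) ab).
- rewrite bits_take bits_drop; split=> [[[a b] /= <- <-]|].
    rewrite row_mxKl row_mxKr.
    have /IHf -> : span_rel (H0 f) (legl (H0 f) a) (legr (H0 f) a) by exists a.
    have /IHg -> /= : span_rel (H0 g) (legl (H0 g) b) (legr (H0 g) b) by exists b.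
    by rewrite bits_row.
  case E: (sem f _) => [u|//] /=; case F: (sem g _) => [v|//] /= [].
  have [z zu] := bits_surj (size_sem (size_bits _) E).
  have [w wu] := bits_surj (size_sem (size_bits _) F).
  rewrite -zu -wu -bits_row => /bits_inj <-.
  have /IHf[a ax az] : sem f (bits (lsubmx x)) = Some (bits z) by rewrite zu.
  have /IHg[b bx bw] : sem g (bits (rsubmx x)) = Some (bits w) by rewrite wu.
  by exists (a, b) => /=; rewrite ?ax ?bx ?az ?bw ?hsubmxK.
- rewrite bits_take bits_drop -bits_row.
  split=> [[a /= <- <- //]|[/bits_inj <-]]; by exists x.
- have -> : Some [:: nth false (bits x) 0; nth false (bits x) 0 (+) nth false (bits x) 1]
      = Some (bits (cnot_fun x)).
    by rewrite bits_cnot.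
  by split=> [[a /= <- <- //]|[/bits_inj <-]]; exists x.
- rewrite -bits_const1.
  by split=> [[a _ <- //]|[/bits_inj <-]]; exists x.
- rewrite bits0; split=> [[a /= <- _]|]; first by rewrite bits_const1.
  case E: nth => // _; exists y => //=; apply: bits_inj; rewrite bits_const1.
  by move: E (size_bits x); case: (bits x) => [|b [|]] //= ->.
Qed.

Lemma sem_castc n m n' m' (en : n = n') (em : m = m') (f : circ n m) :
  sem (castc en em f) = sem f.
Proof. by case: n' / en; case: m' / em. Qed.

Lemma ceq_sem n m (f g : circ n m) s : f ≡ g -> size s = n -> sem f s = sem g s.
Proof.
move=> fg; elim: fg s => {n m f g}.
- by [].
- by move=> n m f g _ IH s ss; rewrite IH.
- by move=> n m f g h _ IH1 _ IH2 s ss; rewrite IH1 ?IH2.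
- move=> n m k f f' g g' _ IH1 _ IH2 s ss /=; rewrite IH1 //.
  case E: (sem f' s) => [t|//] /=; apply: IH2; exact: size_sem E.
- move=> n m n' m' f f' g g' _ IH1 _ IH2 s ss /=.
  by rewrite IH1 ?IH2 ?size_drop ?size_takel ?ss ?addKn ?leq_addr.
- by move=> n m k l f g h s ss /=; case: (sem f s).
- by [].
- by move=> n m f s ss /=; case: (sem f s).
- by move=> n m s ss /=; rewrite cat_take_drop.
- move=> n m k n' m' k' f g f' g' s ss /=.
  case E: (sem f _) => [u|//] /=; case F: (sem f' _) => [v|] /=; last first.
    by case: (sem g u).
  have su : size u = m by apply: size_sem E; rewrite size_takel ?ss ?leq_addr.
  by rewrite take_size_cat // drop_size_cat.
- move=> n m n' m' n'' m'' f g h s ss; rewrite sem_castc /=.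
  rewrite take_takel ?leq_addr // take_drop [(n' + n)%N]addnC drop_drop.
  rewrite [(n' + n)%N]addnC.
  case: (sem f _) => [u|//] /=; case: (sem g _) => [v|//] /=.
  by case: (sem h _) => [w|//] /=; rewrite catA.
- by move=> n m f s ss; rewrite sem_castc /= take0 drop0 /=; case: (sem f s).
- move=> n m f s ss; rewrite sem_castc /= take_oversize ?ss // drop_oversize ?ss //.
  by case: (sem f s) => //= u; rewrite cats0.
- move=> n m n' m' f g s ss /=.
  have st : size (drop n s) = n' by rewrite size_drop ss addKn.
  rewrite take_size_cat // drop_size_cat //.
  case E: (sem f _) => [u|] /=; last by case: (sem g _).
  case: (sem g _) => [v|//] /=.
  have su : size u = m by apply: size_sem E; rewrite size_takel ?ss ?leq_addr.
  by rewrite take_size_cat // drop_size_cat.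
- move=> m n s ss /=; have st : size (drop m s) = n by rewrite size_drop ss addKn.
  by rewrite take_size_cat // drop_size_cat // cat_take_drop.
- move=> m n p s ss.
  rewrite -[RHS]/(obind (sem (castc erefl (addnA n p m) (ctens (idc n) (csym m p))))
    (sem (castc (esym (addnA m n p)) (esym (addnA n m p))
      (ctens (csym m n) (idc p))) s)) !sem_castc /=.
  have [a [t [-> sa st]]] :
      exists a t, [/\ s = a ++ t, size a = m & size t = (n + p)%N].
    exists (take m s), (drop m s); rewrite cat_take_drop size_drop size_takel ss.
      by rewrite addKn.
    by rewrite leq_addr.
  have [b [c [-> sb]]] : exists b c, t = b ++ c /\ size b = n.
    by exists (take n t), (drop n t); rewrite cat_take_drop size_takel ?st ?leq_addr.
  have sab : size (a ++ b) = (m + n)%N by rewrite size_cat sa sb.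
  have -> : take (m + n) (a ++ b ++ c) = a ++ b by rewrite catA take_size_cat.
  have -> : drop (m + n) (a ++ b ++ c) = c by rewrite catA drop_size_cat.
  rewrite !(take_size_cat _ sa) !(drop_size_cat _ sa) -!catA.
  rewrite (take_size_cat _ sb) !(drop_size_cat _ sb).
  by rewrite (take_size_cat _ sa) (drop_size_cat _ sa).
all: by case=> [|[] [|[] [|[] [|]]]].
Qed.

Theorem H0_ceq n m (f g : circ n m) : f ≡ g -> pariso_eq (H0 f) (H0 g).
Proof.
move=> fg; apply/span_eqP => x y; split=> /H0_sem e; apply/H0_sem; move: e;
  by rewrite (ceq_sem fg) ?size_bits.
Qed.

(* Main.v *)
(* A clause is the idempotent that adds an affine form of the wires to an ancilla
   in state |0> and then tests that the ancilla is still |0>. The relations of CNOT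
   show that clauses commute, that multiplying by one clause allows it to be added to
   another, and, by CNT9, that the clause 1 = 0 absorbs all the others. Each gate [f]
   can be moved past clauses, [f ;; clause] becoming [clause' ;; f], and [f ;; f°] is
   itself a product of clauses; hence so is every restriction idempotent. Two such
   products with the same solutions imply each other's equations by Gaussian
   elimination, and are therefore equal; and every affine subset of Z_2^n is the
   solution set of some clauses. *)

From Stdlib Require Import Setoid Morphisms.
From mathcomp Require Import all_boot all_algebra boolp.
Require Import Defs.

Set Implicit Arguments.
Unset Strict Implicit.
Unset Printing Implicit Defensive.

Local Open Scope circ_scope.

(** Faithfulness goes through absorption, with no normal form for circuits: two products with the
    same solutions satisfy p p' = p and p' p = p', and they commute. The obstacle is an
    unsatisfiable system, where elimination may yield 1 = 0 without yielding the equations of the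
    other system; the clause of 1 = 0 is the zero scalar <1|0>, which must therefore swallow clauses
    on every wire. With ancillas, laws about equations become laws about cnot gates aimed at
    ancillas or between them, and the constant term is a cnot whose control is fed by |1>.
    Subcircuits of an idempotent need not be idempotent, so the induction runs over all circuits f
    with a claim about f f°, and e = e e° enters at the end. *)

Lemma castc_irr n m n' m' (en en' : n = n') (em em' : m = m') (f : circ n m) :
  castc en em f = castc en' em' f.
Proof. by rewrite (eq_irrelevance en en') (eq_irrelevance em em'). Qed.

Lemma tensA_cast n m n' m' n'' m'' (f : circ n m) (g : circ n' m')
    (h : circ n'' m'') en em :
  castc en em (f ⊗ (g ⊗ h)) ≡ f ⊗ g ⊗ h.
Proof. by rewrite (castc_irr _ (addnA _ _ _) _ (addnA _ _ _)) ceq_tensA. Qed.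

(** * Gates on [n] wires *)

(* Tensoring on the left with [idc 1], and on the right only concrete gates with
   [idc n], keeps every arity in the form [n.+k] up to conversion, so no cast is
   ever needed. *)
Definition shift n m (f : circ n m) : circ n.+1 m.+1 := idc 1 ⊗ f.
Definition swapn n : circ n.+2 n.+2 := swap ⊗ idc n.
Definition cnotn n : circ n.+2 n.+2 := cnot ⊗ idc n.
Definition ketn n : circ n n.+1 := ket1 ⊗ idc n.
Definition bran n : circ n.+1 n := bra1 ⊗ idc n.
Definition not1 : circ 1 1 := (ket1 ⊗ idc 1) ;; cnot ;; (bra1 ⊗ idc 1).
Definition notn n : circ n.+1 n.+1 := not1 ⊗ idc n.
(* Control on the second wire, target on the first. *)
Definition cnotrn n : circ n.+2 n.+2 := swapn n ;; cnotn n ;; swapn n.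

#[local] Instance shift_ceq n m : Proper (@ceq n m ==> @ceq n.+1 m.+1) (@shift n m).
Proof. by move=> f g fg; rewrite /shift fg. Qed.

#[local] Instance castc_ceq n m n' m' en em :
  Proper (@ceq n m ==> @ceq n' m') (@castc n m n' m' en em).
Proof. by case: n' / en; case: m' / em => f g. Qed.

Lemma comp2_tail n m k l (a : circ n m) (b : circ m k) r (x : circ k l) :
  a ;; b ≡ r -> a ;; (b ;; x) ≡ r ;; x.
Proof. by move=> <-; rewrite ceq_compA. Qed.

Lemma comp3_tail n m k l p (a : circ n m) (b : circ m k) (c : circ k l) r
    (x : circ l p) :
  a ;; b ;; c ≡ r -> a ;; (b ;; (c ;; x)) ≡ r ;; x.
Proof. by move=> <-; rewrite !ceq_compA. Qed.

(* Compositions are kept associated to the right; [rw] also applies a relation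
   [a ;; b ≡ c] to a subterm [a ;; (b ;; x)]. *)
Ltac ra := rewrite -?ceq_compA.
Ltac rw H := (first [rewrite (comp3_tail _ H) | rewrite (comp2_tail _ H) | rewrite H
  | rewrite (ceq_compA _ _ _) H]); rewrite -?ceq_compA.

Lemma pad_comp n m k p (f : circ n m) (g : circ m k) :
  (f ;; g) ⊗ idc p ≡ (f ⊗ idc p) ;; (g ⊗ idc p).
Proof. by rewrite -ceq_interchange ceq_idl. Qed.

Lemma pad_compl n m k (p : nat) (f : circ n m) (g : circ m k) :
  idc p ⊗ (f ;; g) ≡ (idc p ⊗ f) ;; (idc p ⊗ g).
Proof. by rewrite -ceq_interchange ceq_idl. Qed.

Lemma tens_split n m n' m' (f : circ n m) (g : circ n' m') :
  f ⊗ g ≡ (f ⊗ idc n') ;; (idc m ⊗ g).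
Proof. by rewrite -ceq_interchange ceq_idl ceq_idr. Qed.

Lemma tens_split' n m n' m' (f : circ n m) (g : circ n' m') :
  f ⊗ g ≡ (idc n ⊗ g) ;; (f ⊗ idc m').
Proof. by rewrite -ceq_interchange ceq_idl ceq_idr. Qed.

Lemma tens_comm n m n' m' (f : circ n m) (g : circ n' m') :
  (f ⊗ idc n') ;; (idc m ⊗ g) ≡ (idc n ⊗ g) ;; (f ⊗ idc m').
Proof. by rewrite -tens_split -tens_split'. Qed.

Lemma shift_id n : shift (idc n) ≡ idc n.+1.
Proof. exact: (ceq_tens_id 1 n). Qed.

Lemma shift_comp n m k (f : circ n m) (g : circ m k) :
  shift (f ;; g) ≡ shift f ;; shift g.
Proof. exact: (pad_compl 1 f g). Qed.

Lemma shift2 n m (f : circ n m) : shift (shift f) ≡ idc 2 ⊗ f.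
Proof.
by apply: ceq_trans (@tensA_cast 1 1 1 1 n m _ _ f erefl erefl) _; rewrite ceq_tens_id.
Qed.

Lemma shift_pad n m p (f : circ n m) : shift f ⊗ idc p ≡ shift (f ⊗ idc p).
Proof. symmetry; exact: (@tensA_cast 1 1 n m p p _ f _ erefl erefl). Qed.

Lemma padA k l n p (f : circ k l) en em :
  castc en em (f ⊗ idc (n + p)) ≡ f ⊗ idc n ⊗ idc p.
Proof. by rewrite -(tensA_cast f (idc n) (idc p) en em) ceq_tens_id. Qed.

Lemma pad2 n p (f : circ 2 2) :
  (f ⊗ idc (n + p) : circ (n + p).+2 (n + p).+2) ≡ (f ⊗ idc n ⊗ idc p).
Proof. exact: (@padA 2 2 n p f erefl erefl). Qed.

Lemma tens0l n m (f : circ n m) : (idc 0 ⊗ f : circ n m) ≡ f.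
Proof. by rewrite -{2}(ceq_tens0l f) (castc_irr _ erefl _ erefl). Qed.

Lemma swapn_swapn n : swapn n ;; swapn n ≡ idc n.+2.
Proof.
exact: ceq_trans (ceq_sym (pad_comp n swap swap))
  (ceq_trans (ceq_tens (ceq_symK 1 1) (ceq_refl _)) (ceq_tens_id 2 n)).
Qed.

Lemma cnotn_cnotn n : cnotn n ;; cnotn n ≡ idc n.+2.
Proof.
exact: ceq_trans (ceq_sym (pad_comp n cnot cnot))
  (ceq_trans (ceq_tens CNT2 (ceq_refl _)) (ceq_tens_id 2 n)).
Qed.

Lemma swapn_shift n m (f : circ n m) :
  swapn n ;; shift (shift f) ≡ shift (shift f) ;; swapn m.
Proof. rewrite shift2; exact: (tens_comm swap f). Qed.

Lemma cnotn_shift n m (f : circ n m) :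
  cnotn n ;; shift (shift f) ≡ shift (shift f) ;; cnotn m.
Proof. rewrite shift2; exact: (tens_comm cnot f). Qed.

Lemma notn_shift n m (f : circ n m) : notn n ;; shift f ≡ shift f ;; notn m.
Proof. exact: (tens_comm not1 f). Qed.

Lemma ketn_shift n m (f : circ n m) : ketn n ;; shift f ≡ f ;; ketn m.
Proof. by apply: ceq_trans (tens_comm ket1 f) _; rewrite tens0l. Qed.

Lemma shift_bran n m (f : circ n m) : shift f ;; bran m ≡ bran n ;; f.
Proof. by symmetry; apply: ceq_trans _ (tens_comm bra1 f); rewrite tens0l. Qed.

Lemma csym12 : csym 1 2 ≡ (swap ⊗ idc 1) ;; (idc 1 ⊗ swap).
Proof.
apply: ceq_trans (ceq_hexagon 1 1 1) _.
rewrite (castc_irr _ erefl _ erefl).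
by rewrite [X in _ ;; X](castc_irr _ erefl _ erefl).
Qed.

Lemma pad_swapn n : swap ⊗ idc 1 ⊗ idc n ≡ swapn n.+1.
Proof. by rewrite -pad2. Qed.

Lemma pad_cnotn n : cnot ⊗ idc 1 ⊗ idc n ≡ cnotn n.+1.
Proof. by rewrite -pad2. Qed.

Lemma pad_shift n (f : circ 2 2) :
  idc 1 ⊗ f ⊗ idc n ≡ shift (f ⊗ idc n : circ n.+2 n.+2).
Proof. exact: (@shift_pad 2 2 n f). Qed.

Lemma pad_ketn n : ket1 ⊗ idc 1 ⊗ idc n ≡ ketn n.+1.
Proof. symmetry; exact: (@padA 0 1 1 n ket1 erefl erefl). Qed.

Lemma pad_bran n : bra1 ⊗ idc 1 ⊗ idc n ≡ bran n.+1.
Proof. symmetry; exact: (@padA 1 0 1 n bra1 erefl erefl). Qed.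

Ltac pad n H :=
  have := ceq_tens H (ceq_refl (idc n));
  rewrite /C3_21 /C3_12 /C3_23 /C3_32 /C3_13 /C2_21 /C2_12;
  rewrite ?pad_compl ?pad_comp ?pad_shift ?pad_swapn ?pad_cnotn ?pad_ketn ?pad_bran.

(** Naturality of [csym 1 2], which the hexagon splits into two swaps. Taking [g] to be [swap] gives
    the braid relation, and [cnot] its mixed variant. *)
Lemma gate2_swapn (g : circ 2 2) :
  (idc 1 ⊗ g) ;; ((swap ⊗ idc 1) ;; (idc 1 ⊗ swap)) ≡
  (swap ⊗ idc 1) ;; (idc 1 ⊗ swap) ;; (g ⊗ idc 1).
Proof. by rewrite -csym12; exact: (ceq_sym_nat (idc 1) g). Qed.

Lemma yang_baxter n :
  shift (swapn n) ;; swapn n.+1 ;; shift (swapn n) ≡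
    swapn n.+1 ;; shift (swapn n) ;; swapn n.+1.
Proof. by pad n (gate2_swapn swap); rewrite ceq_compA. Qed.

Lemma cnotn_swapn n :
  shift (cnotn n) ;; swapn n.+1 ;; shift (swapn n) ≡
    swapn n.+1 ;; shift (swapn n) ;; cnotn n.+1.
Proof. by pad n (gate2_swapn cnot); rewrite ceq_compA. Qed.

Lemma shift_swapn_swapn n : shift (swapn n) ;; shift (swapn n) ≡ idc n.+3.
Proof. by rewrite -shift_comp swapn_swapn shift_id. Qed.

Lemma swapn_cnotn n :
  cnotn n.+1 ;; shift (swapn n) ;; swapn n.+1 ≡
    shift (swapn n) ;; swapn n.+1 ;; shift (cnotn n).
Proof.
have {1}-> : cnotn n.+1 ≡ shift (swapn n) ;; swapn n.+1 ;; (shift (cnotn n) ;;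
  swapn n.+1 ;; shift (swapn n)).
  by rewrite cnotn_swapn; ra; rw (swapn_swapn n.+1); rewrite ceq_idl;
    rw (shift_swapn_swapn n); rewrite ceq_idl.
by ra; rw (shift_swapn_swapn n); rewrite ceq_idl swapn_swapn ceq_idr.
Qed.

Lemma CNT3n n : cnotrn n.+1 ;; shift (cnotn n) ≡ shift (cnotn n) ;; cnotrn n.+1.
Proof. by pad n CNT3. Qed.

Lemma CNT5n n : cnotn n.+1 ;; shift (cnotrn n) ≡ shift (cnotrn n) ;; cnotn n.+1.
Proof. by rewrite /cnotrn !shift_comp; pad n CNT5. Qed.

Lemma CNT8n n : cnotn n.+1 ;; shift (cnotn n) ;; cnotn n.+1 ≡
  shift (cnotn n) ;; (shift (swapn n) ;; cnotn n.+1 ;; shift (swapn n)).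
Proof. by pad n CNT8. Qed.

Lemma CNT1n n : cnotn n ;; cnotrn n ;; cnotn n ≡ swapn n.
Proof. by pad n CNT1. Qed.

Lemma ketn_bran n : ketn n ;; bran n ≡ idc n.
Proof. by pad n CNT6 => h; exact: ceq_trans h (tens0l (idc n)). Qed.

(** CNT4 lets the control |1> be recovered after the gate; what remains on the target is [not1] by
    definition. *)
Lemma ketn_cnotn n : ketn n.+1 ;; cnotn n ≡ notn n ;; ketn n.+1.
Proof. by pad n CNT4_ket; rewrite /notn /not1 ?pad_comp ?pad_ketn ?pad_bran. Qed.

Lemma notnE n : notn n ≡ ketn n.+1 ;; cnotn n ;; bran n.+1.
Proof. by rewrite /notn /not1 !pad_comp pad_ketn pad_bran. Qed.

Lemma notn_notn n : notn n ;; notn n ≡ idc n.+1.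
Proof.
by rewrite {2}notnE; ra; rw (ceq_sym (ketn_cnotn n)); rw (cnotn_cnotn n);
  rewrite ceq_idl ketn_bran.
Qed.

Lemma tens0r0 (f : circ 0 0) : (f ⊗ idc 0 : circ 0 0) ≡ f.
Proof. by rewrite -{2}(ceq_tens0r f) (castc_irr _ erefl _ erefl). Qed.

Lemma tens0r1 (f : circ 1 1) : (f ⊗ idc 0 : circ 1 1) ≡ f.
Proof. by rewrite -{2}(ceq_tens0r f) (castc_irr _ erefl _ erefl). Qed.

Lemma tens0r2 (f : circ 0 2) : (f ⊗ idc 0 : circ 0 2) ≡ f.
Proof. by rewrite -{2}(ceq_tens0r f) (castc_irr _ erefl _ erefl). Qed.

(** Yields the unit coherence of the symmetry: the hexagon makes [csym 0 0] and [csym 1 0]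
    idempotent, and they are invertible. *)
Lemma idem_inv_id n (c d : circ n n) : c ≡ c ;; c -> c ;; d ≡ idc n -> c ≡ idc n.
Proof.
move=> cc cd; transitivity (c ;; (c ;; d)); first by rewrite cd ceq_idr.
by rewrite ceq_compA -cc.
Qed.

Lemma csym00 : (csym 0 0 : circ 0 0) ≡ idc 0.
Proof.
apply: idem_inv_id (ceq_symK 0 0).
apply: ceq_trans (ceq_hexagon 0 0 0) _.
rewrite (castc_irr _ erefl _ erefl) [X in _ ;; X](castc_irr _ erefl _ erefl).
exact: ceq_comp (tens0r0 _) (tens0l _).
Qed.

Lemma csym10 : (csym 1 0 : circ 1 1) ≡ idc 1.
Proof.
apply: idem_inv_id (ceq_symK 1 0).
apply: ceq_trans (ceq_hexagon 1 0 0) _.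
rewrite (castc_irr _ erefl _ erefl) [X in _ ;; X](castc_irr _ erefl _ erefl).
exact: ceq_comp (tens0r1 _) (tens0l _).
Qed.

Lemma csym01 : (csym 0 1 : circ 1 1) ≡ idc 1.
Proof. exact: cflip_ceq csym10. Qed.

Lemma ketn_swapn n : ketn n.+1 ;; swapn n ≡ shift (ketn n).
Proof.
have h : (ket1 ⊗ idc 1) ;; swap ≡ idc 1 ⊗ ket1.
  apply: ceq_trans (ceq_sym_nat ket1 (idc 1)) _.
  by apply: ceq_trans (ceq_idl (idc 1 ⊗ ket1)); exact: ceq_comp csym01 _.
by pad n h => {}h; apply: ceq_trans h (@shift_pad 0 1 n ket1).
Qed.

Lemma swapn_bran n : swapn n ;; bran n.+1 ≡ shift (bran n).
Proof. exact: cflip_ceq (ketn_swapn n). Qed.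

Lemma pad_notn n : not1 ⊗ idc 1 ⊗ idc n ≡ notn n.+1.
Proof. symmetry; exact: (@padA 1 1 1 n not1 erefl erefl). Qed.

Lemma notn_swapn n : notn n.+1 ;; swapn n ≡ swapn n ;; shift (notn n).
Proof.
have h := ceq_tens (ceq_sym_nat not1 (idc 1)) (ceq_refl (idc n)).
rewrite -(pad_notn n).
apply: ceq_trans (ceq_sym (pad_comp n _ _)) (ceq_trans h _).
apply: ceq_trans (pad_comp n _ _) _.
exact: ceq_comp (ceq_refl _) (@shift_pad 1 1 n not1).
Qed.

Lemma shift_notn_swapn n : shift (notn n) ;; swapn n ≡ swapn n ;; notn n.+1.
Proof.
transitivity (swapn n ;; (notn n.+1 ;; swapn n) ;; swapn n).
  by rewrite notn_swapn ceq_compA swapn_swapn ceq_idl.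
by ra; rewrite swapn_swapn ceq_idr.
Qed.

Lemma cflip_notn n : cflip (notn n) ≡ notn n.
Proof.
have h : cflip not1 ≡ not1 by rewrite /= ceq_compA.
exact: ceq_tens h (ceq_refl (idc n)).
Qed.

(** * The state |0> and the zero scalar *)

Definition ket0n n : circ n n.+1 := (ket1 ;; not1) ⊗ idc n.
Definition bra0n n : circ n.+1 n := (not1 ;; bra1) ⊗ idc n.

Lemma ket0nE n : ket0n n ≡ ketn n ;; notn n.
Proof. exact: (pad_comp n ket1 not1). Qed.

Lemma bra0nE n : bra0n n ≡ notn n ;; bran n.
Proof. exact: (pad_comp n not1 bra1). Qed.

Lemma cflip_ket0n n : cflip (ket0n n) ≡ bra0n n.
Proof.
have h : cflip (ket1 ;; not1) ≡ not1 ;; bra1 by rewrite /= ceq_compA.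
exact: ceq_tens h (ceq_refl (idc n)).
Qed.

Lemma ket0n_shift n m (f : circ n m) : ket0n n ;; shift f ≡ f ;; ket0n m.
Proof. by apply: ceq_trans (tens_comm (ket1 ;; not1) f) _; rewrite tens0l. Qed.

Lemma shift_bra0n n m (f : circ n m) : shift f ;; bra0n m ≡ bra0n n ;; f.
Proof.
by symmetry; apply: ceq_trans _ (tens_comm (not1 ;; bra1) f); rewrite tens0l.
Qed.

Lemma ket0n_swapn n : ket0n n.+1 ;; swapn n ≡ shift (ket0n n).
Proof. by rewrite !ket0nE -ceq_compA notn_swapn ceq_compA ketn_swapn shift_comp. Qed.

Lemma swapn_bra0n n : swapn n ;; bra0n n.+1 ≡ shift (bra0n n).
Proof.
by rewrite !bra0nE ceq_compA -shift_notn_swapn -ceq_compA swapn_bran shift_comp.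
Qed.

Lemma pad_ketn2 n : ket1 ⊗ ket1 ⊗ idc n ≡ ketn n ;; ketn n.+1.
Proof.
have -> : ket1 ⊗ ket1 ≡ ket1 ;; (ket1 ⊗ idc 1).
  apply: ceq_trans (tens_split' ket1 ket1) _.
  exact: ceq_comp (tens0l _) (ceq_refl _).
by rewrite pad_comp pad_ketn.
Qed.

Lemma pad_ketn2_1 n : ket1 ⊗ ket1 ⊗ idc 1 ⊗ idc n ≡ ketn n.+1 ;; ketn n.+2.
Proof.
have h := @padA 0 2 1 n (ket1 ⊗ ket1) erefl erefl.
exact: ceq_trans (ceq_sym h) (pad_ketn2 n.+1).
Qed.

Lemma pad_bran2 n : bra1 ⊗ idc 2 ⊗ idc n ≡ bran n.+2.
Proof. symmetry; exact: (@padA 1 0 2 n bra1 erefl erefl). Qed.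

(** In CNT7 the first cnot has control |1> and negates the second |1>, so the relation says that a
    control in |0> does nothing. *)
Lemma ket0n_cnotn n : ket0n n.+1 ;; cnotn n ≡ ket0n n.+1.
Proof.
pad n CNT7_ket; rewrite pad_ketn2_1 pad_bran2; ra.
rewrite !(comp2_tail _ (ketn_cnotn n.+1)); ra; rewrite shift_bran; ra.
by rewrite (comp2_tail _ (ketn_bran _)) ketn_bran ceq_idl ceq_idr ket0nE; ra.
Qed.

Lemma cnotn_bra0n n : cnotn n ;; bra0n n.+1 ≡ bra0n n.+1.
Proof. by rewrite -cflip_ket0n; exact: cflip_ceq (ket0n_cnotn n). Qed.

Lemma ket0n_bra0n n : ket0n n ;; bra0n n ≡ idc n.
Proof.
by rewrite ket0nE bra0nE; ra; rewrite (comp2_tail _ (notn_notn n)) ceq_idl ketn_bran.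
Qed.

(** The scalar <1|0>, whose image under [H0] is nowhere defined, beside [n] idle wires. *)
Definition absurdn n : circ n n := (ket1 ;; not1 ;; bra1) ⊗ idc n.

Lemma absurdnE n : absurdn n ≡ ketn n ;; notn n ;; bran n.
Proof. by rewrite -ket0nE; exact: (pad_comp n (ket1 ;; not1) bra1). Qed.

Lemma pad_ketn2_bra n : ket1 ⊗ ket1 ⊗ bra1 ⊗ idc n ≡ bran n ;; (ketn n ;; ketn n.+1).
Proof.
have -> : ket1 ⊗ ket1 ⊗ bra1 ≡ bra1 ;; (ket1 ⊗ ket1).
  apply: ceq_trans (tens_split' (ket1 ⊗ ket1) bra1) _.
  exact: ceq_comp (tens0l _) (tens0r2 _).
by rewrite pad_comp; exact: ceq_comp _ (pad_ketn2 n).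
Qed.

(** CNT9 cuts a wire that lies beside the zero scalar. *)
Lemma absurdn_bran_ketn n : absurdn n.+1 ≡ bran n ;; absurdn n ;; ketn n.
Proof.
pad n CNT9.
have -> : bra1 ⊗ bra1 ⊗ idc 1 ⊗ idc n ≡ bran n.+2 ;; bran n.+1.
  exact: cflip_ceq (pad_ketn2_1 n).
have -> : bra1 ⊗ bra1 ⊗ ket1 ⊗ idc n ≡ bran n.+1 ;; bran n ;; ketn n.
  exact: cflip_ceq (pad_ketn2_bra n).
rewrite pad_ketn2_1 pad_ketn2_bra; ra.
rewrite (comp2_tail _ (ketn_cnotn n.+1)) -!/(cnotn n) (comp2_tail _ (ketn_cnotn n)); ra.
by rewrite !(comp2_tail _ (ketn_bran _)) !ceq_idl !absurdnE; ra.
Qed.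

Definition ccomm n (f g : circ n n) : Prop := f ;; g ≡ g ;; f.

#[local] Instance ccomm_ceq n : Proper (@ceq n n ==> @ceq n n ==> iff) (@ccomm n).
Proof. by move=> f f' ff g g' gg; rewrite /ccomm ff gg. Qed.

Lemma ccomm_sym n (f g : circ n n) : ccomm f g -> ccomm g f.
Proof. by rewrite /ccomm => ->. Qed.

Lemma ccomm_id n (f : circ n n) : ccomm f (idc n).
Proof. by rewrite /ccomm ceq_idl ceq_idr. Qed.

Lemma ccomm_comp n (f g h : circ n n) : ccomm f g -> ccomm f h -> ccomm f (g ;; h).
Proof. by rewrite /ccomm => fg fh; rewrite ceq_compA fg; ra; rewrite fh; ra. Qed.

Lemma ccomm_compl n (f g h : circ n n) : ccomm f h -> ccomm g h -> ccomm (f ;; g) h.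
Proof. by move=> fh gh; apply/ccomm_sym/ccomm_comp; apply/ccomm_sym. Qed.

Lemma conj_comp n (s f g : circ n n) : s ;; s ≡ idc n ->
  s ;; f ;; s ;; (s ;; g ;; s) ≡ s ;; (f ;; g) ;; s.
Proof. by move=> ss; ra; rewrite (comp2_tail _ ss) ceq_idl. Qed.

Lemma comp_ACA n (f g h k : circ n n) : ccomm g h ->
  f ;; g ;; (h ;; k) ≡ f ;; h ;; (g ;; k).
Proof. by rewrite /ccomm => gh; ra; rewrite (comp2_tail _ gh); ra. Qed.

Lemma ccomm_conj n (s f g : circ n n) : s ;; s ≡ idc n ->
  ccomm f g -> ccomm (s ;; f ;; s) (s ;; g ;; s).
Proof. by rewrite /ccomm => ss fg; rewrite !conj_comp // fg. Qed.

Lemma ccomm_shift n (f g : circ n n) : ccomm f g -> ccomm (shift f) (shift g).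
Proof. by rewrite /ccomm -!shift_comp => ->. Qed.

Lemma cnotrn_cnotrn n : cnotrn n ;; cnotrn n ≡ idc n.+2.
Proof.
by rewrite /cnotrn conj_comp ?swapn_swapn // cnotn_cnotn ceq_idr swapn_swapn.
Qed.

(** * Adding an affine form of the wires to an ancilla *)

(* [f] acting on all the wires except the second one. *)
Definition skip1 n (f : circ n.+1 n.+1) :
  circ n.+2 n.+2 := swapn n ;; shift f ;; swapn n.

#[local] Instance skip1_ceq n : Proper (@ceq n.+1 n.+1 ==> @ceq n.+2 n.+2) (@skip1 n).
Proof. by move=> f g fg; rewrite /skip1 fg. Qed.

Lemma skip1_id n : skip1 (idc n.+1) ≡ idc n.+2.
Proof. by rewrite /skip1 shift_id ceq_idr swapn_swapn. Qed.

Lemma skip1_comp n (f g : circ n.+1 n.+1) : skip1 (f ;; g) ≡ skip1 f ;; skip1 g.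
Proof. by rewrite /skip1 conj_comp ?swapn_swapn // shift_comp. Qed.

Lemma skip1_notn n : skip1 (notn n) ≡ notn n.+1.
Proof. by rewrite /skip1 -notn_swapn -ceq_compA swapn_swapn ceq_idr. Qed.

Section ThreeWires.
Variable n : nat.
(** [A] and [X] act on the first two wires, [B] and [Y] on the second and third; the lemmas of the
    section are mostly word computations with these involutions. *)
Let A := swapn n.+1.
Let B := shift (swapn n).
Let X := cnotn n.+1.
Let Y := shift (cnotn n).
Let AA : A ;; A ≡ idc n.+3 := swapn_swapn n.+1.
Let BB : B ;; B ≡ idc n.+3 := shift_swapn_swapn n.
Let XX : X ;; X ≡ idc n.+3 := cnotn_cnotn n.+1.
Let YY : Y ;; Y ≡ idc n.+3.
Proof. by rewrite -shift_comp cnotn_cnotn shift_id. Qed.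
Let BAB : B ;; A ;; B ≡ A ;; B ;; A := yang_baxter n.
Let YAB : Y ;; A ;; B ≡ A ;; B ;; X := cnotn_swapn n.
Let XBA : X ;; B ;; A ≡ B ;; A ;; Y := swapn_cnotn n.

Ltac can := ra; repeat (first
  [ rewrite (comp2_tail _ AA) ceq_idl | rewrite (comp2_tail _ BB) ceq_idl
  | rewrite (comp2_tail _ XX) ceq_idl | rewrite (comp2_tail _ YY) ceq_idl
  | rewrite AA | rewrite BB | rewrite XX | rewrite YY
  | rewrite ceq_idl | rewrite ceq_idr]).

Lemma shift_cnotnE : Y ≡ A ;; B ;; X ;; B ;; A.
Proof. by rewrite -YAB; can. Qed.

Lemma conj_shift_cnotn : A ;; Y ;; A ≡ B ;; X ;; B.
Proof. by rewrite shift_cnotnE; can. Qed.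

Lemma shift_cnotrnE : shift (cnotrn n) ≡ B ;; Y ;; B.
Proof. by rewrite /cnotrn !shift_comp. Qed.

Lemma conj_cnotrnE : A ;; shift (cnotrn n) ;; A ≡ B ;; cnotrn n.+1 ;; B.
Proof.
rewrite shift_cnotrnE /cnotrn shift_cnotnE -/A -/B -/X; can.
rewrite (comp3_tail _ (ceq_sym BAB)); can.
have -> : B ;; (A ;; (B ;; A)) ≡ A ;; B by rewrite (comp3_tail _ BAB); can.
by [].
Qed.

Lemma ccomm_cnotrn_cnotrn : ccomm (cnotrn n.+1) (skip1 (cnotrn n)).
Proof. exact: ccomm_conj AA (CNT5n n). Qed.

Lemma cnotn_conj : Y ;; X ;; Y ≡ B ;; X ;; B ;; X.
Proof.
have h : X ;; Y ;; X ≡ Y ;; (B ;; X ;; B) := CNT8n n.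
have -> : B ;; X ;; B ≡ Y ;; (X ;; Y ;; X) by rewrite h; can.
by can.
Qed.

(** With ancillas on wires 1 and 2, conjugation by the cnot from 1 to 2 copies the gate from 3 to 1
    into one from 3 to 2. This is the one-variable case of [cnotn_parity]. *)
Lemma cnotn_skip1_cnotrn :
  X ;; skip1 (cnotrn n) ;; X ≡ skip1 (cnotrn n) ;; shift (cnotrn n).
Proof.
have QZ : ccomm (skip1 (cnotrn n)) (shift (cnotrn n)).
  by rewrite /skip1 conj_cnotrnE shift_cnotrnE; exact: ccomm_conj BB (CNT3n n).
have QE : skip1 (cnotrn n) ≡ B ;; A ;; X ;; A ;; B.
  by rewrite /skip1 conj_cnotrnE /cnotrn -/A -/X; can.
transitivity (B ;; A ;; (Y ;; X ;; Y) ;; A ;; B).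
  have XE : X ≡ B ;; A ;; Y ;; A ;; B by rewrite shift_cnotnE; can.
  by rewrite {1 2}XE QE; can.
by rewrite QZ cnotn_conj QE shift_cnotrnE shift_cnotnE; can.
Qed.

Variable f : circ n.+1 n.+1.

Lemma skip2E : skip1 (skip1 f) ≡ A ;; shift (skip1 f) ;; A.
Proof. by []. Qed.

Lemma ccomm_skip2_swapn : ccomm (skip1 (skip1 f)) B.
Proof.
rewrite /ccomm /skip1 !shift_comp -/A -/B; can.
rewrite (comp3_tail _ BAB); ra; have := swapn_shift f => h.
rewrite (comp2_tail _ h); ra; rewrite -/A.
have := BAB; rewrite -!ceq_compA => h'.
by rewrite h'.
Qed.

Lemma ccomm_skip2_cnotn : ccomm (skip1 (skip1 f)) Y.
Proof.
rewrite /ccomm /skip1 !shift_comp -/A -/B; can.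
rewrite (comp3_tail _ YAB); ra; rewrite (comp2_tail _ (cnotn_shift f)); ra.
by have := XBA; rewrite -!ceq_compA => ->.
Qed.

Lemma ccomm_skip2_shift_cnotrn : ccomm (skip1 (skip1 f)) (shift (cnotrn n)).
Proof.
rewrite shift_cnotrnE; apply: ccomm_comp ccomm_skip2_swapn;
  apply: ccomm_comp ccomm_skip2_cnotn.
exact: ccomm_skip2_swapn.
Qed.

Lemma ccomm_cnotrn_skip2 :
  ccomm (cnotrn n) (skip1 f) -> ccomm (cnotrn n.+1) (skip1 (skip1 f)).
Proof.
move=> h; apply: ccomm_conj AA _.
(* [A ;; B ;; A] exchanges the first and third wires, both avoided by [shift (skip1 f)], and carries
   [shift (cnotrn n)] to [cnotn n.+1]. *)
have hU : ccomm (A ;; B ;; A) (shift (skip1 f)).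
  have -> : shift (skip1 f) ≡ A ;; skip1 (skip1 f) ;; A by rewrite skip2E; can.
  by apply: ccomm_conj AA _; apply/ccomm_sym/ccomm_skip2_swapn.
have -> : cnotn n.+1 ≡ A ;; B ;; A ;; shift (cnotrn n) ;; (A ;; B ;; A).
  by rewrite shift_cnotrnE shift_cnotnE -BAB -/X; can.
by apply: ccomm_compl (hU); apply: ccomm_compl (hU) (ccomm_shift h).
Qed.

Lemma cnotn_skip2 : cnotn n ;; skip1 f ;; cnotn n ≡ skip1 f ;; shift f ->
  X ;; skip1 (skip1 f) ;; X ≡ skip1 (skip1 f) ;; shift (skip1 f).
Proof.
move=> h; have := ccomm_skip2_swapn; rewrite /ccomm => hB.
have hV : skip1 (skip1 f) ≡ B ;; skip1 (skip1 f) ;;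
  B by rewrite -hB -(ceq_compA (skip1 (skip1 f))) BB ceq_idr.
have UE : shift (skip1 f) ≡ B ;; shift (shift f) ;; B by rewrite /skip1 !shift_comp.
have XE : X ≡ B ;; (A ;; Y ;; A) ;; B by rewrite conj_shift_cnotn; can.
transitivity (B ;; A ;; shift (cnotn n ;; skip1 f ;; cnotn n) ;; A ;; B).
  by rewrite {1}hV skip2E XE !shift_comp -/Y; can.
rewrite h hV UE skip2E shift_comp; can.
by rewrite (comp2_tail _ (ceq_sym (swapn_shift f))); ra.
Qed.
End ThreeWires.

(** Since [notn] is a cnot whose control is fed by |1>, commutation with that cnot passes to the
    negation. *)
Lemma ccomm_ketn_bran n (g : circ n n) (c : circ n.+1 n.+1) :
  ccomm (shift g) c -> ccomm g (ketn n ;; c ;; bran n).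
Proof.
rewrite /ccomm => h; ra.
by rewrite (comp2_tail _ (ceq_sym (ketn_shift g))); ra; rewrite (comp2_tail _ h); ra;
  rewrite shift_bran.
Qed.

Lemma ccomm_cnotrn_notn n : ccomm (cnotrn n) (notn n.+1).
Proof. by rewrite notnE; apply/ccomm_ketn_bran/ccomm_sym/CNT5n. Qed.

Lemma cnotn_notn n : cnotn n ;; notn n.+1 ;; cnotn n ≡ notn n.+1 ;; shift (notn n).
Proof.
rewrite {1}notnE; ra; rewrite (comp2_tail _ (ceq_sym (ketn_shift (cnotn n)))); ra.
rewrite -shift_bran (comp3_tail _ (cnotn_conj n)); ra.
rewrite (comp2_tail _ (ketn_shift (swapn n))); ra.
rewrite (comp2_tail _ (ketn_cnotn n.+1)); ra.
rewrite (comp2_tail _ (ketn_shift (swapn n))) -ceq_compA (comp2_tail _ (ketn_cnotn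
  n.+1)); ra.
rewrite ketn_bran ceq_idr notn_shift.
by rewrite (comp2_tail _ (notn_swapn n)); ra;
  rewrite (comp2_tail _ (swapn_swapn n)) ceq_idl.
Qed.

(* Replaces the first wire [a] by [a (+) b (+) s 0 x_0 (+) ... (+) s n.-1 x_n.-1]. *)
Fixpoint parity n (b : bool) (s : nat -> bool) : circ n.+1 n.+1 :=
  match n with
  | 0 => if b then notn 0 else idc 1
  | n.+1 => (if s 0 then cnotrn n else idc n.+2) ;; skip1 (parity n b (fun i => s i.+1))
  end.

Definition xorf (s t : nat -> bool) i := s i (+) t i.

Lemma parity_ext n b s t :
  (forall i, i < n -> s i = t i) -> parity n b s = parity n b t.
Proof.
by elim: n s t => //= n IH s t st; rewrite st // (IH _ (fun i => t i.+1)) // => i iltn;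
  apply: st.
Qed.

Lemma parity0 n : parity n false (fun=> false) ≡ idc n.+1.
Proof. by elim: n => //= n ->; rewrite skip1_id ceq_idl. Qed.

Lemma parity1 n : parity n true (fun=> false) ≡ notn n.
Proof. by elim: n => //= n ->; rewrite skip1_notn ceq_idl. Qed.

Lemma ccomm_cnotrn_parity n b s : ccomm (cnotrn n) (skip1 (parity n b s)).
Proof.
elim: n s => [|n IH] s /=.
  by case: b; rewrite ?skip1_notn ?skip1_id; [exact: ccomm_cnotrn_notn|exact: ccomm_id].
rewrite skip1_comp; apply: ccomm_comp; last exact: ccomm_cnotrn_skip2.
by case: (s 0); rewrite ?skip1_id; [exact: ccomm_cnotrn_cnotrn|exact: ccomm_id].
Qed.

Lemma parity_add n b c s t :
  parity n b s ;; parity n c t ≡ parity n (b (+) c) (xorf s t).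
Proof.
elim: n s t => [|n IH] s t /=.
  by case: b c => -[] /=; rewrite ?ceq_idl ?ceq_idr ?notn_notn.
rewrite -IH skip1_comp /xorf.
move: (ccomm_cnotrn_parity n b (fun i => s i.+1)) (cnotrn_cnotrn n).
move: (skip1 _) (skip1 _) (cnotrn n) => v v' x h xx.
case: (s 0) (t 0) => -[] /=; rewrite ?ceq_idl; ra => //.
- by rewrite (comp2_tail _ (ceq_sym h)); ra; rewrite (comp2_tail _ xx) ceq_idl.
- by rewrite (comp2_tail _ h); ra.
Qed.

(* Copying the ancilla onto a second one copies the form that is added to it;
   polarising this identity gives [ccomm_parity2]. *)
Lemma cnotn_parity n b s :
  cnotn n ;; skip1 (parity n b s) ;; cnotn n ≡
    skip1 (parity n b s) ;; shift (parity n b s).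
Proof.
elim: n s => [|n IH] s /=.
  by case: b; rewrite ?skip1_notn ?skip1_id ?shift_id ?cnotn_notn // !ceq_idr
    cnotn_cnotn.
rewrite skip1_comp; set f := parity n b _; set D := if _ then _ else _.
rewrite -conj_comp ?cnotn_cnotn // cnotn_skip2; last exact: IH.
have -> : cnotn n.+1 ;; skip1 D ;; cnotn n.+1 ≡ skip1 D ;; shift D.
  rewrite /D; case: (s 0); first exact: cnotn_skip1_cnotrn.
  by rewrite skip1_id shift_id !ceq_idr cnotn_cnotn.
rewrite shift_comp; apply/comp_ACA/ccomm_sym.
rewrite /D; case: (s 0); first exact: ccomm_skip2_shift_cnotrn.
by rewrite shift_id; exact: ccomm_id.
Qed.

Lemma parity_inv n b s : parity n b s ;; parity n b s ≡ idc n.+1.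
Proof.
rewrite parity_add addbb -(parity0 n) (@parity_ext n false _ (fun=> false)) // => i _.
by rewrite /xorf addbb.
Qed.

Lemma ccomm_parity2 n b c s t : ccomm (skip1 (parity n b s)) (shift (parity n c t)).
Proof.
(* Copying the sum of the two forms gives w w' u u', while copying them one by one gives w u w' u';
   cancelling the involutions w and u' leaves w' u = u w'. *)
have := cnotn_parity n (c (+) b) (xorf t s).
rewrite -parity_add skip1_comp shift_comp -conj_comp ?cnotn_cnotn // !cnotn_parity.
have := skip1_comp (parity n c t) (parity n c t); rewrite parity_inv skip1_id => ww.
have := shift_comp (parity n b s) (parity n b s); rewrite parity_inv shift_id => uu.
move: ww uu; move: (skip1 (parity n c t)) (skip1 (parity n b s)) (shift (parity n c t))
  (shift (parity n b s)).
move=> w w' u u' ww uu h.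
rewrite /ccomm; transitivity (w ;; (w ;; w' ;; (u ;; u')) ;; u').
  by ra; rewrite -uu (comp2_tail _ (ceq_sym ww)) !ceq_idl ceq_idr.
by rewrite -h; ra; rewrite -uu (comp2_tail _ (ceq_sym ww)) !ceq_idl ceq_idr.
Qed.

(** * Clauses *)

(* The equation [b (+) s . x = 0]: the ancilla starts in |0> and is tested to
   still be in |0>. *)
Definition clausec n b s : circ n n := ket0n n ;; parity n b s ;; bra0n n.

(** Both ancillas are prepared at the start and tested at the end, so that the gates of the two
    clauses meet in the middle and can be rearranged. *)
Lemma clausec_comp_gen n (f g : circ n.+1 n.+1) :
  ket0n n ;; f ;; bra0n n ;; (ket0n n ;; g ;; bra0n n) ≡
  ket0n n ;; ket0n n.+1 ;; (shift f ;; skip1 g) ;; (bra0n n.+1 ;; bra0n n).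
Proof.
rewrite /skip1; ra; rewrite (comp2_tail _ (swapn_bra0n n)) (comp2_tail _ (ket0n_shift
  f)); ra.
rewrite (comp2_tail _ (ket0n_swapn n)).
rewrite -(shift_bra0n (ket0n n ;; (g ;; bra0n n))) !shift_comp; ra.
by rewrite !shift_bra0n; ra.
Qed.

Lemma ket0n2_swapn n : ket0n n ;; ket0n n.+1 ;; swapn n ≡ ket0n n ;; ket0n n.+1.
Proof. by rewrite -ceq_compA ket0n_swapn ket0n_shift. Qed.

Lemma swapn_bra0n2 n : swapn n ;; (bra0n n.+1 ;; bra0n n) ≡ bra0n n.+1 ;; bra0n n.
Proof. by rewrite ceq_compA swapn_bra0n shift_bra0n. Qed.

Lemma clausec_comm n b c s t : ccomm (clausec n b s) (clausec n c t).
Proof.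
rewrite /ccomm /clausec !clausec_comp_gen;
  move: (parity n b s) (parity n c t) (ccomm_parity2 n b c s t) => w w' h.
transitivity (ket0n n ;; ket0n n.+1 ;; (skip1 w ;; shift w') ;; (bra0n n.+1 ;;
  bra0n n)); last by rewrite h.
(* Two ancillas in |0> are interchangeable: a swap inserted at both ends exchanges their roles. *)
rewrite -{1}ket0n2_swapn -{1}swapn_bra0n2; move: (ket0n n ;; ket0n n.+1) (bra0n n.+1 ;;
  bra0n n) => k b'.
by rewrite /skip1; ra; rewrite (comp2_tail _ (swapn_swapn n)) ceq_idl.
Qed.

Lemma ccomm_cnotn_parity n b s : ccomm (cnotn n) (shift (parity n b s)).
Proof.
have := ccomm_conj (swapn_swapn n) (ccomm_cnotrn_parity n b s); rewrite /cnotrn /skip1;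
  ra.
by rewrite !swapn_swapn !ceq_idr !(comp2_tail _ (swapn_swapn n)) !ceq_idl.
Qed.

(* An ancilla in |0> controls nothing, so a cnot between the two ancillas may be
   inserted at both ends; conjugating by it adds one clause to the other. *)
Lemma clausec_add n b c s t :
  clausec n b s ;; clausec n c t ≡ clausec n (b (+) c) (xorf s t) ;; clausec n c t.
Proof.
rewrite /clausec !clausec_comp_gen -parity_add shift_comp.
have h : ket0n n ;; ket0n n.+1 ;; cnotn n ≡
  ket0n n ;; ket0n n.+1 by rewrite -ceq_compA ket0n_cnotn.
have h' : cnotn n ;; (bra0n n.+1 ;; bra0n n) ≡
  bra0n n.+1 ;; bra0n n by rewrite ceq_compA cnotn_bra0n.
rewrite -{1}h -{1}h'.
have := ccomm_parity2 n c c t t; have := ccomm_cnotn_parity n b s;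
  have := cnotn_parity n c t.
move: (skip1 (parity n c t)) (shift (parity n b s)) (shift (parity n c t)) (ket0n n ;;
  ket0n n.+1) (bra0n n.+1 ;; bra0n n) => v u u' k b' e1 e2 e3.
by ra; rewrite (comp2_tail _ e2); ra; rewrite (comp3_tail _ e1) e3; ra.
Qed.

Lemma clausec_ext n b s t :
  (forall i, i < n -> s i = t i) -> clausec n b s = clausec n b t.
Proof. by move=> st; rewrite /clausec (parity_ext _ st). Qed.

Lemma clausec0 n : clausec n false (fun=> false) ≡ idc n.
Proof. by rewrite /clausec parity0 ceq_idr ket0n_bra0n. Qed.

Lemma clausec_idem n b s : clausec n b s ;; clausec n b s ≡ clausec n b s.
Proof.
rewrite clausec_add addbb (@clausec_ext n _ (xorf s s) (fun=> false)) ?clausec0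
  ?ceq_idl // => i _.
by rewrite /xorf addbb.
Qed.

Lemma cflip_parity n b s : cflip (parity n b s) ≡ parity n b s.
Proof.
elim: n s => [|n IH] s; first by case: b => //=; exact: cflip_notn.
set w := parity n b (fun i => s i.+1); set D := if s 0 then cnotrn n else idc n.+2.
change (cflip (skip1 w) ;; cflip D ≡ D ;; skip1 w).
have -> : cflip (skip1 w) ≡ skip1 w by rewrite -{2}[w]IH; exact: ceq_compA.
rewrite /D; case: (s 0); last by rewrite ceq_idl ceq_idr.
by rewrite (ccomm_cnotrn_parity n b); apply: ceq_comp => //; exact: ceq_compA.
Qed.

Lemma cflip_clausec n b s : cflip (clausec n b s) ≡ clausec n b s.
Proof.
change (cflip (bra0n n) ;; (cflip (parity n b s) ;; cflip (ket0n n)) ≡ clausec n b s).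
have -> : cflip (bra0n n) ≡ ket0n n by rewrite -[ket0n n]cflipK;
  apply/cflip_ceq/ceq_sym/cflip_ket0n.
by rewrite cflip_parity cflip_ket0n ceq_compA.
Qed.

(** * Pulling affine forms back along circuits *)

(** Precomposition with [f] turns an affine form of the outputs into one of the inputs; the ancilla,
    kept aside by [shift], receives it. *)
Definition pullable n m (f : circ n m) : Prop := forall b s, exists b' s',
  shift f ;; parity m b s ≡ parity n b' s' ;; shift f.

Definition scons (a : bool) (s : nat -> bool) i := if i is j.+1 then s j else a.

Lemma pullable_ceq n m (f g : circ n m) : f ≡ g -> pullable f -> pullable g.
Proof.
by move=> fg Pf b s; have [b' [s' h]] := Pf b s; exists b', s'; rewrite -fg.
Qed.

Lemma pullable_id n : pullable (idc n).
Proof. by move=> b s; exists b, s; rewrite shift_id ceq_idl ceq_idr. Qed.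

Lemma pullable_comp n m k (f : circ n m) (g : circ m k) :
  pullable f -> pullable g -> pullable (f ;; g).
Proof.
move=> Pf Pg b s; have [b' [s' h]] := Pg b s; have [b'' [s'' h']] := Pf b' s'.
by exists b'', s''; rewrite shift_comp -ceq_compA h ceq_compA h' ceq_compA.
Qed.

Lemma pullable_shift n m (f : circ n m) : pullable f -> pullable (shift f).
Proof.
move=> Pf b s; have [b' [s' h]] := Pf b (fun i => s i.+1).
exists b', (scons (s 0) s') => /=; rewrite -/(scons _ _).
have hV : shift (shift f) ;; skip1 (parity m b (fun i => s i.+1)) ≡
  skip1 (parity n b' s') ;; shift (shift f).
  rewrite /skip1; ra; rewrite (comp2_tail _ (ceq_sym (swapn_shift f))); ra;
    rewrite swapn_shift.
  by rewrite (comp2_tail _ (ceq_sym (shift_comp _ _))) h shift_comp; ra.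
rewrite -[X in _ ≡ X]ceq_compA -hV ceq_compA; case: (s 0); last first.
  by rewrite ceq_idl ceq_idr.
rewrite ceq_compA; apply: ceq_comp => //.
rewrite /cnotrn; ra; rewrite (comp2_tail _ (ceq_sym (swapn_shift f))); ra.
by rewrite (comp2_tail _ (ceq_sym (cnotn_shift f))); ra; rewrite swapn_shift.
Qed.

Lemma parity_SS n b s : parity n.+2 b s ≡
  (if s 0 then cnotrn n.+1 else idc n.+3) ;;
  ((if s 1 then skip1 (cnotrn n) else idc n.+3) ;; skip1 (skip1 (parity n b (fun i =>
    s i.+2)))).
Proof.
rewrite /= skip1_comp; apply: ceq_comp => //; apply: ceq_comp => //.
by case: (s 1); rewrite ?skip1_id.
Qed.

Lemma shift_swapn_cnotrn n :
  shift (swapn n) ;; cnotrn n.+1 ≡ skip1 (cnotrn n) ;; shift (swapn n).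
Proof.
by rewrite /skip1 conj_cnotrnE -(ceq_compA (shift (swapn n) ;;
  cnotrn _)) shift_swapn_swapn ceq_idr.
Qed.

Lemma shift_swapn_skip1_cnotrn n :
  shift (swapn n) ;; skip1 (cnotrn n) ≡ cnotrn n.+1 ;; shift (swapn n).
Proof.
by rewrite /skip1 conj_cnotrnE !(ceq_compA (shift (swapn n))) shift_swapn_swapn ceq_idl.
Qed.

Lemma pullable_swapn n : pullable (swapn n).
Proof.
move=> b s; exists b, (scons (s 1) (scons (s 0) (fun i => s i.+2))).
rewrite !parity_SS /=.
have := ccomm_skip2_swapn (parity n b (fun i => s i.+2)).
move: (shift_swapn_cnotrn n) (shift_swapn_skip1_cnotrn n) (ccomm_cnotrn_cnotrn n).
move: (skip1 (skip1 _)) (skip1 _) (cnotrn n.+1) (shift (swapn n)) =>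
  v x y B e1 e2 e3 e4.
case: (s 0) (s 1) => -[]; rewrite ?ceq_idl; ra.
- by rewrite (comp2_tail _ e1); ra; rewrite (comp2_tail _ e2); ra;
  rewrite (comp2_tail _ (ceq_sym e3)) e4; ra.
- by rewrite (comp2_tail _ e1); ra; rewrite e4.
- by rewrite (comp2_tail _ e2); ra; rewrite e4.
- by rewrite e4.
Qed.

(** After the cnot the target holds the sum of the two wires, so adding it to the ancilla amounts to
    adding both wires before the cnot. *)
Lemma shift_cnotn_skip1_cnotrn n :
  shift (cnotn n) ;; skip1 (cnotrn n) ≡
    skip1 (cnotrn n) ;; (cnotrn n.+1 ;; shift (cnotn n)).
Proof.
have h := CNT8n n.
have YE := shift_cnotnE n.
have -> : skip1 (cnotrn n) ≡ swapn n.+1 ;; (shift (swapn n) ;; shift (cnotn n) ;;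
  shift (swapn n)) ;; swapn n.+1.
  by rewrite /skip1 shift_cnotrnE.
have YY : shift (cnotn n) ;; shift (cnotn n) ≡
  idc n.+3 by rewrite -shift_comp cnotn_cnotn shift_id.
move: (swapn_swapn n.+1) (shift_swapn_swapn n) (cnotn_cnotn n.+1) YY h YE;
  rewrite /cnotrn.
move: (swapn n.+1) (shift (swapn n)) (cnotn n.+1) (shift (cnotn n)) =>
  A B X Y AA BB XX YY h YE.
transitivity (A ;; B ;; (X ;; Y ;; X) ;; B ;; A ;; Y).
  rewrite {1}YE {3}YE; ra.
  by rewrite !(comp2_tail _ AA, comp2_tail _ BB, comp2_tail _ XX, ceq_idl).
rewrite h; ra.
by rewrite !(comp2_tail _ AA, comp2_tail _ BB, ceq_idl).
Qed.

Lemma pullable_cnotn n : pullable (cnotn n).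
Proof.
(* Coefficients of s0 x0 + s1 (x0 + x1) = (s0 + s1) x0 + s1 x1. *)
move=> b s; exists b, (scons (s 0 (+) s 1) (fun i => s i.+1)).
rewrite !parity_SS /=.
have := ccomm_skip2_cnotn (parity n b (fun i => s i.+2)).
move: (CNT3n n) (shift_cnotn_skip1_cnotrn n) (ccomm_cnotrn_cnotrn n) (cnotrn_cnotrn
  n.+1).
move: (skip1 (skip1 _)) (skip1 _) (cnotrn n.+1) (shift (cnotn n)) =>
  v x y B e1 e2 e3 e5 e4.
case: (s 0) (s 1) => -[] /=; rewrite ?ceq_idl; ra.
- rewrite (comp2_tail _ (ceq_sym e1)); ra; rewrite (comp2_tail _ e2); ra; rewrite -e4.
  by rewrite (comp2_tail _ (ceq_sym e3)); ra; rewrite (comp2_tail _ e5) ceq_idl.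
- by rewrite (comp2_tail _ (ceq_sym e1)); ra; rewrite e4.
- by rewrite (comp2_tail _ e2); ra; rewrite e4 (comp2_tail _ (ceq_sym e3)); ra.
- by rewrite e4.
Qed.

Lemma notn_parity n b s : notn n ;; parity n b s ≡ parity n (~~ b) s.
Proof. by rewrite -parity1 parity_add addTb; rewrite (parity_ext _ (t := s)). Qed.

(** The new wire holds 1, so its coefficient joins the constant term. *)
Lemma ketn_parity n b s : shift (ketn n) ;; parity n.+1 b s ≡
  parity n (s 0 (+) b) (fun i => s i.+1) ;; shift (ketn n).
Proof.
rewrite /= -(ketn_swapn n); set w := parity n b _.
have hV : ketn n.+1 ;; swapn n ;; skip1 w ≡ w ;; (ketn n.+1 ;; swapn n).
  rewrite /skip1; ra; rewrite (comp2_tail _ (swapn_swapn n)) ceq_idl (comp2_tail _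
    (ketn_shift w)); ra.
  by [].
case: (s 0) => /=; last by rewrite ceq_idl.
rewrite -notn_parity -/w -(ceq_compA (notn n)) -hV !ceq_compA.
by rewrite -!ceq_compA (comp2_tail _ (swapn_swapn n)) ceq_idl (comp2_tail _ (ketn_cnotn
  n)); ra.
Qed.

Lemma pullable_ketn n : pullable (ketn n).
Proof. by move=> b s; exists (s 0 (+) b), (fun i => s i.+1); exact: ketn_parity. Qed.

Lemma pullable_bran n : pullable (bran n).
Proof.
move=> b s; exists b, (scons false s) => /=; rewrite ceq_idl.
rewrite -(swapn_bran n) /skip1; ra; rewrite (comp2_tail _ (swapn_swapn n)) ceq_idl.
by rewrite shift_bran.
Qed.

Lemma pullable_clausec n m (f : circ n m) b s : pullable f ->
  exists b' s', f ;; clausec m b s ≡ clausec n b' s' ;; f.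
Proof.
move=> /(_ b s)[b' [s' h]]; exists b', s'.
rewrite /clausec; ra; rewrite (comp2_tail _ (ceq_sym (ket0n_shift f))); ra.
by rewrite (comp2_tail _ h); ra; rewrite shift_bra0n.
Qed.

(* The swap in CNT1 exchanges the tested ancilla with the wire itself. *)
Lemma bran_ketn n : bran n ;; ketn n ≡ clausec n.+1 true (scons true (fun=> false)).
Proof.
rewrite /clausec /= parity1 skip1_notn -ceq_compA.
have -> : ket0n n.+1 ;; (cnotrn n ;; notn n.+1 ;; bra0n n.+1) ≡
  ketn n.+1 ;; (cnotrn n ;; bra0n n.+1).
  rewrite (ccomm_cnotrn_notn n) ket0nE; move: (cnotrn n) => x; ra.
  by rewrite (comp2_tail _ (notn_notn _)) ceq_idl.
(* Of the three cnots that make up the swap, the last is controlled by a wire tested to be |0> and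
   vanishes; the first is controlled by |1> and cancels the leading [notn]. *)
transitivity (notn n ;; (ketn n.+1 ;; ((cnotn n ;; cnotrn n ;; cnotn n) ;;
  bra0n n.+1))).
  rewrite CNT1n swapn_bra0n (ketn_shift (bra0n n)) bra0nE.
  by ra; rewrite (comp2_tail _ (notn_notn n)) ceq_idl.
move: (cnotrn n) => x; ra; rewrite cnotn_bra0n (comp2_tail _ (ketn_cnotn n)); ra.
by rewrite (comp2_tail _ (notn_notn n)) ceq_idl.
Qed.

Lemma shift_clausec n b s : shift (clausec n b s) ≡ clausec n.+1 b (scons false s).
Proof.
rewrite /clausec /= ceq_idl /skip1 !shift_comp; ra.
by rewrite (comp2_tail _ (ket0n_swapn n)) swapn_bra0n.
Qed.

Lemma clausec1 n : clausec n true (fun=> false) ≡ absurdn n.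
Proof.
by rewrite /clausec parity1 ket0nE bra0nE absurdnE; ra;
  rewrite (comp2_tail _ (notn_notn n)) ceq_idl.
Qed.

(* CNT9 lets the inconsistent clause set every wire to 1, after which any
   clause reduces to one without variables. *)
Lemma clausec1_clausec n b s :
  clausec n true (fun=> false) ;; clausec n b s ≡ clausec n true (fun=> false).
Proof.
rewrite !clausec1; elim: n b s => [|n IH] b s.
  case: b; last by rewrite (@clausec_ext 0 _ s (fun=> false)) // clausec0 ceq_idr.
  by rewrite (@clausec_ext 0 _ s (fun=> false)) // -clausec1 clausec_idem.
have h : ketn n ;; clausec n.+1 b s ≡ clausec n (s 0 (+) b) (fun i => s i.+1) ;; ketn n.
  rewrite /clausec; move: (ketn_parity n b s); move: (parity _ _ _) (parity _ _ _) =>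
    w w' h.
  ra; rewrite (comp2_tail _ (ceq_sym (ket0n_shift (ketn n)))); ra.
  by rewrite (comp2_tail _ h); ra; rewrite shift_bra0n.
rewrite absurdn_bran_ketn -(ceq_compA _ (ketn n)) h.
by rewrite -(ceq_compA (bran n)) -(ceq_compA (bran n)) (ceq_compA (absurdn n)) IH
  ceq_compA.
Qed.

(** * Products of clauses *)

(** One type of equations serves every arity: on [n] wires only the first [n] coefficients matter
    ([clausec_ext]). *)
Definition clause := (bool * (nat -> bool))%type.

Definition clauses n (l : seq clause) : circ n n :=
  foldr (fun c e => clausec n c.1 c.2 ;; e) (idc n) l.

Definition clausal n (e : circ n n) : Prop := exists l, e ≡ clauses n l.

Lemma clauses_cat n l1 l2 : clauses n (l1 ++ l2) ≡ clauses n l1 ;; clauses n l2.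
Proof. by elim: l1 => [|c l1 IH] /=; rewrite ?ceq_idl // IH ceq_compA. Qed.

Lemma ccomm_clausec_clauses n b s l : ccomm (clausec n b s) (clauses n l).
Proof.
elim: l => [|c l IH] /=; first exact: ccomm_id.
by apply: ccomm_comp IH; exact: clausec_comm.
Qed.

Lemma ccomm_clauses n l1 l2 : ccomm (clauses n l1) (clauses n l2).
Proof.
elim: l1 => [|c l IH] /=; first exact/ccomm_sym/ccomm_id.
by apply: ccomm_compl IH; exact: ccomm_clausec_clauses.
Qed.

Lemma clauses_idem n l : clauses n l ;; clauses n l ≡ clauses n l.
Proof.
elim: l => [|c l IH] /=; first by rewrite ceq_idl.
have := ccomm_clausec_clauses n c.1 c.2 l; have := clausec_idem n c.1 c.2.
move: (clausec _ _ _) (clauses n l) IH => p q qq pp pq.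
by ra; rewrite (comp2_tail _ (ceq_sym pq)); ra; rewrite (comp2_tail _ pp) qq.
Qed.

Lemma cflip_clauses n l : cflip (clauses n l) ≡ clauses n l.
Proof.
elim: l => //= c l IH.
by rewrite IH (ccomm_clausec_clauses n c.1 c.2 l); apply: ceq_comp => //;
  exact: cflip_clausec.
Qed.

Lemma crest_idem_clauses n l : crest_idem (clauses n l).
Proof. by rewrite /crest_idem /crst cflip_clauses clauses_idem. Qed.

Lemma clausal_ceq n (e f : circ n n) : e ≡ f -> clausal e -> clausal f.
Proof. by move=> ef [l h]; exists l; rewrite -ef. Qed.

Lemma clausal_comp n (e f : circ n n) : clausal e -> clausal f -> clausal (e ;; f).
Proof. by move=> [l h] [l' h']; exists (l ++ l'); rewrite clauses_cat h h'. Qed.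

Lemma clausal_shift n (e : circ n n) : clausal e -> clausal (shift e).
Proof.
move=> [l h]; exists [seq (c.1, scons false c.2) | c <- l]; rewrite {}h.
elim: l => [|c l IH] /=; first exact: shift_id.
by rewrite shift_comp IH shift_clausec.
Qed.

Lemma pullable_clauses n m (f : circ n m) l : pullable f ->
  exists l', f ;; clauses m l ≡ clauses n l' ;; f.
Proof.
move=> Pf; elim: l => [|c l [l' IH]] /=.
  by exists [::]; rewrite /= ceq_idl ceq_idr.
have [b' [s' h]] := pullable_clausec c.1 c.2 Pf.
exists ((b', s') :: l') => /=.
rewrite ceq_compA h -(ceq_compA _ f) IH ceq_compA; reflexivity.
Qed.

(** The second condition alone does not pass to composites: (f g)(f g)° is f (g g°) f°, and the
    clauses of g g° must first be pulled through f. *)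
Definition tame n m (f : circ n m) : Prop := pullable f /\ clausal (crst f).

Lemma tame_ceq n m (f g : circ n m) : f ≡ g -> tame f -> tame g.
Proof.
move=> fg [Pf Nf]; split; first exact: pullable_ceq fg Pf.
by apply: clausal_ceq Nf; rewrite /crst (cflip_ceq fg) fg.
Qed.

Lemma tame_comp n m k (f : circ n m) (g : circ m k) : tame f -> tame g -> tame (f ;; g).
Proof.
move=> [Pf Nf] [Pg [l h]]; split; first exact: pullable_comp.
have [l' h'] := pullable_clauses l Pf.
apply: (@clausal_ceq _ (clauses n l' ;; crst f)); last by apply: clausal_comp => //;
  exists l'.
rewrite {1}/crst ceq_compA -h' -h /crst /= !ceq_compA; reflexivity.
Qed.

Lemma clausal_id n : clausal (idc n).
Proof. by exists [::]. Qed.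

Lemma tame_shift n m (f : circ n m) : tame f -> tame (shift f).
Proof.
move=> [Pf Nf]; split; first exact: pullable_shift.
by apply: clausal_ceq (clausal_shift Nf); rewrite /crst shift_comp.
Qed.

Lemma tame_id n : tame (idc n).
Proof.
by split; [exact: pullable_id|apply: clausal_ceq (clausal_id n); rewrite /crst ceq_idl].
Qed.

Lemma tame_swapn n : tame (swapn n).
Proof.
by split; [exact: pullable_swapn|apply: clausal_ceq (clausal_id _); symmetry;
  exact: swapn_swapn].
Qed.

Lemma tame_cnotn n : tame (cnotn n).
Proof.
by split; [exact: pullable_cnotn|apply: clausal_ceq (clausal_id _); symmetry;
  exact: cnotn_cnotn].
Qed.

Lemma tame_ketn n : tame (ketn n).
Proof.
by split; [exact: pullable_ketn|apply: clausal_ceq (clausal_id _); symmetry;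
  exact: ketn_bran].
Qed.

Lemma tame_bran n : tame (bran n).
Proof.
split; [exact: pullable_bran|exists [:: (true, scons true (fun=> false))] => /=].
by rewrite ceq_idr; exact: bran_ketn.
Qed.

Lemma tame_castc n m n' m' (en : n = n') (em : m = m') (f : circ n m) :
  tame f -> tame (castc en em f).
Proof. by case: n' / en; case: m' / em. Qed.

(** * Every restriction idempotent is a product of clauses *)

(** Padding on the left follows from [tame_shift]; padding on the right is built into the property
    so that the induction on circuits passes through tensors, by [tens_split]. *)
Definition stably_tame n m (f : circ n m) : Prop := forall p, tame (f ⊗ idc p).

Lemma stably_tame_ceq n m (f g : circ n m) : f ≡ g -> stably_tame f -> stably_tame g.
Proof. by move=> fg Gf p; apply: tame_ceq (Gf p); rewrite fg. Qed.

Lemma stably_tame_castc n m n' m' (en : n = n') (em : m = m') (f : circ n m) :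
  stably_tame f -> stably_tame (castc en em f).
Proof. by case: n' / en; case: m' / em. Qed.

Lemma stably_tame_comp n m k (f : circ n m) (g : circ m k) :
  stably_tame f -> stably_tame g -> stably_tame (f ;; g).
Proof.
move=> Gf Gg p; apply: tame_ceq (tame_comp (Gf p) (Gg p)).
by rewrite pad_comp.
Qed.

Lemma stably_tame_id n : stably_tame (idc n).
Proof. by move=> p; apply: tame_ceq (tame_id (n + p)); rewrite ceq_tens_id. Qed.

Lemma stably_tame_pad n m p (f : circ n m) : stably_tame f -> stably_tame (f ⊗ idc p).
Proof.
move=> Gf q; apply: tame_ceq (padA f (addnA n p q) (addnA m p q)) _.
exact: tame_castc.
Qed.

Lemma tame_padl n m p (f : circ n m) : tame f -> tame (idc p ⊗ f).
Proof.
move=> Gf; elim: p => [|p IH]; first by apply: tame_ceq Gf; rewrite tens0l.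
apply: tame_ceq (tame_shift IH).
apply: ceq_trans (@tensA_cast 1 1 p p n m _ _ f erefl erefl) _.
by apply: ceq_tens => //; exact: (ceq_tens_id 1 p).
Qed.

Lemma stably_tame_padl n m p (f : circ n m) : stably_tame f -> stably_tame (idc p ⊗ f).
Proof.
move=> Gf q; apply: tame_ceq (ceq_tensA (idc p) f (idc q)) _.
by apply/tame_castc/tame_padl/Gf.
Qed.

Lemma stably_tame_tens n m n' m' (f : circ n m) (g : circ n' m') :
  stably_tame f -> stably_tame g -> stably_tame (f ⊗ g).
Proof.
move=> Gf Gg; apply: stably_tame_ceq (stably_tame_comp (stably_tame_pad n' Gf)
  (stably_tame_padl m Gg)).
by rewrite -tens_split.
Qed.

Lemma stably_tame_csymDr m n p :
  stably_tame (csym m n) -> stably_tame (csym m p) -> stably_tame (csym m (n + p)).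
Proof.
move=> G1 G2; apply: stably_tame_ceq (ceq_sym (ceq_hexagon m n p)) _.
apply: stably_tame_comp; apply: stably_tame_castc;
  [exact: stably_tame_pad|exact: stably_tame_padl].
Qed.

Lemma stably_tame_csymDl m n p :
  stably_tame (csym m p) -> stably_tame (csym n p) -> stably_tame (csym (m + n) p).
Proof.
(* The flipped hexagon splits the first argument of the symmetry. *)
move=> G1 G2; apply: stably_tame_ceq (ceq_sym (cflip_ceq (ceq_hexagon p m n))) _.
rewrite cflip_comp !cflip_castc.
apply: stably_tame_comp; apply: stably_tame_castc;
  [exact: stably_tame_padl|exact: stably_tame_pad].
Qed.

Lemma stably_tame_csym m n : stably_tame (csym m n).
Proof.
have G0 : forall n, stably_tame (csym 0 n).
  elim=> [|k IH]; first exact: stably_tame_ceq (ceq_sym csym00) (stably_tame_id 0).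
  apply: (@stably_tame_csymDr 0 1 k) => //.
  exact: stably_tame_ceq (ceq_sym csym01) (stably_tame_id 1).
have G1 : forall n, stably_tame (csym 1 n).
  elim=> [|k IH]; first exact: stably_tame_ceq (ceq_sym csym10) (stably_tame_id 1).
  by apply: (@stably_tame_csymDr 1 1 k) => // p; exact: tame_swapn.
by elim: m => [|m IH] //; exact: (@stably_tame_csymDl 1 m n).
Qed.

Lemma stably_tame_circ n m (f : circ n m) : stably_tame f.
Proof.
elim: f => {n m} [n|n m k f Gf g Gg|n m n' m' f Gf g Gg|m n|||].
- exact: stably_tame_id.
- exact: stably_tame_comp.
- exact: stably_tame_tens.
- exact: stably_tame_csym.
- exact: tame_cnotn.
- exact: tame_ketn.
- exact: tame_bran.
Qed.

Lemma clausal_crest_idem n (e : circ n n) : crest_idem e -> clausal e.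
Proof.
move=> ee; apply: clausal_ceq (ceq_sym ee) _.
have [_] : tame e.
  exact: tame_ceq (ceq_tens0r e) (tame_castc _ _ (stably_tame_circ e 0)).
by [].
Qed.

(** * Clauses as affine equations over bit strings *)

Fixpoint dot (s : nat -> bool) (x : seq bool) : bool :=
  if x is a :: x' then (s 0 && a) (+) dot (fun i => s i.+1) x' else false.

Definition holds (x : seq bool) (c : clause) : bool := c.1 (+) dot c.2 x == false.

Lemma sem_comp n m k (f : circ n m) (g : circ m k) x :
  sem (f ;; g) x = obind (sem g) (sem f x).
Proof. by []. Qed.

Lemma obindS (T U : Type) (f : T -> option U) x : obind f (Some x) = f x.
Proof. by []. Qed.

Lemma sem_shift n m (f : circ n m) a x :
  sem (shift f) (a :: x) = omap (cons a) (sem f x).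
Proof. by rewrite /= take0 drop0. Qed.

Lemma sem_swapn n a b x : sem (swapn n) [:: a, b & x] = Some [:: b, a & x].
Proof. by rewrite /= take0 drop0. Qed.

Lemma sem_cnotn n a b x : sem (cnotn n) [:: a, b & x] = Some [:: a, a (+) b & x].
Proof. by rewrite /= drop0. Qed.

Lemma sem_cnotrn n a b x : sem (cnotrn n) [:: a, b & x] = Some [:: a (+) b, b & x].
Proof.
by rewrite /cnotrn !sem_comp sem_swapn /obind /oapp sem_cnotn sem_swapn addbC.
Qed.

Lemma sem_notn n a x : sem (notn n) (a :: x) = Some (~~ a :: x).
Proof. by rewrite /= ?take0 ?drop0. Qed.

Lemma sem_parity n b s a x : size x = n ->
  sem (parity n b s) (a :: x) = Some ((a (+) b (+) dot s x) :: x).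
Proof.
elim: n s a x => [|n IH] s a [|c x] //.
  by move=> _; case: b; rewrite /parity ?sem_notn /=; case: a.
move=> [sx]; rewrite [parity _ _ _]/= sem_comp.
have -> : sem (if s 0 then cnotrn n else idc n.+2) [:: a, c & x] =
    Some [:: a (+) (s 0 && c), c & x].
  by case: (s 0); rewrite ?sem_cnotrn //= addbF.
rewrite obindS /skip1 !sem_comp sem_swapn obindS sem_shift IH // obindS sem_swapn [dot
  _ (_ :: _)]/=.
by rewrite -!addbA (addbCA _ b).
Qed.

Lemma sem_clausec n b s x : size x = n ->
  sem (clausec n b s) x = if holds x (b, s) then Some x else None.
Proof.
move=> sx.
have k0x : sem (ket0n n) x = Some (false :: x).
  by rewrite (ceq_sem (ket0nE n)) // sem_comp /= ?take0 ?drop0 /=.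
have b0x a : sem (bra0n n) (a :: x) = if a then None else Some x.
  rewrite (ceq_sem (bra0nE n)) /= ?sx //.
  by case: a => /=; rewrite ?take0 ?drop0.
rewrite /clausec !sem_comp k0x obindS sem_parity // obindS b0x /holds /=.
by case: b; case: (dot s x).
Qed.

Lemma sem_clauses n l x : size x = n ->
  sem (clauses n l) x = if all (holds x) l then Some x else None.
Proof.
move=> sx; elim: l => [|[b s] l IH] //.
by rewrite [clauses _ _]/= sem_comp sem_clausec //=; case: (holds x (b, s)).
Qed.

Lemma dot_xorf s t x : dot (xorf s t) x = dot s x (+) dot t x.
Proof.
elim: x s t => [|a x IH] s t //=.
rewrite -[fun i => _]/(xorf (fun i => s i.+1) (fun i => t i.+1)) IH /xorf.
by case: (s 0) (t 0) a (dot _ x) (dot _ x) => -[] [] [] [].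
Qed.

Lemma dot0 x : dot (fun=> false) x = false.
Proof. by elim: x. Qed.

(* Gaussian elimination on a set of affine equations closed under addition. *)
Lemma affine_consequence n (I : bool -> (nat -> bool) -> Prop) b s :
  (forall b s t, (forall i, i < n -> s i = t i) -> I b s -> I b t) ->
  I false (fun=> false) ->
  (forall b c s t, I b s -> I c t -> I (b (+) c) (xorf s t)) ->
  (forall x, size x = n -> (forall b s, I b s -> holds x (b, s)) -> holds x (b, s)) ->
  I b s \/ I true (fun=> false).
Proof.
elim: n I b s => [|n IH] I b s ext I0 ID sol.
  have [I1|nI1] := pselect (I true (fun=> false)); [by right|left].
  apply: (ext _ (fun=> false)) => //; case: b sol => // sol.
  have : holds [::] (true, s) by apply: sol => // -[] t It //; case: nI1; exact: ext It.
  by [].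
(* The equations of [I] in which the first variable does not occur. *)
pose I' b s := I b (scons false s).
have ext' c t u : (forall i, i < n -> t i = u i) -> I' c t -> I' c u.
  by move=> tu; apply: ext => -[|i] //=; apply: tu.
have I0' : I' false (fun=> false) by apply: ext I0 => -[].
have ID' c d t u : I' c t -> I' d u -> I' (c (+) d) (xorf t u).
  by move=> It Iu; apply: ext (ID _ _ _ _ It Iu) => -[].
have I1' : I' true (fun=> false) -> I true (fun=> false) by apply: ext => -[].
have tl c t : t 0 = false -> I c t -> I' c (fun i => t i.+1).
  by move=> t0; apply: ext => -[].
have lt c t : t 0 = false -> I' c (fun i => t i.+1) -> I c t.
  by move=> t0; apply: ext => -[].
have [[c [u [u0 Iu]]]|noI] := pselect (exists c u, u 0 = true /\ I c u).
  (* A pivot [(c, u)] eliminates the first variable from every equation. *)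
  pose red d (t : nat -> bool) := if t 0 then (c (+) d, xorf u t) else (d, t).
  have red0 d t : (red d t).2 0 = false.
    by rewrite /red; case E: (t 0) => //=; rewrite /xorf u0 E.
  have redI d t : I (red d t).1 (red d t).2 <-> I d t.
    rewrite /red; case: (t 0) => //=; split=> [h|]; last exact: ID.
    have := ID _ _ _ _ Iu h; rewrite addKb; apply: ext => i _.
    by rewrite /xorf addKb.
  have [||||h|/I1'] := IH I' (red b s).1 (fun i => (red b s).2 i.+1) => //.
  - move=> x sx Ix.
    (* The pivot forces this value of the first variable. *)
    pose y := (c (+) dot (fun i => u i.+1) x) :: x.
    have yu : holds y (c, u).
      by rewrite /holds /= u0 /= -addbA addbb addbF addbb.
    have yred d t : holds y (d, t) = holds x ((red d t).1, fun i => (red d t).2 i.+1).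
      have -> : holds y (d, t) = holds y (red d t).
        rewrite /red; case: (t 0) => //; move: yu; rewrite /holds.
        rewrite [_.1]/= [_.2]/= dot_xorf => /eqP h.
        have -> : c (+) d (+) (dot u y (+) dot t y) = d (+) dot t y => //.
        by move: h; move: (dot u y) (dot t y); clear; case: c d => -[] [] [].
      by move: (red0 d t); rewrite /holds /=; move: (red d t) => [d' t'] /= ->.
    rewrite -yred; apply: sol => [|d t It]; first by rewrite /= sx.
    by rewrite yred; apply: Ix; apply: tl => //; apply/redI.
  - by left; apply/redI; apply: lt.
  - by right.
have noI0 c t : I c t -> t 0 = false.
  by move=> It; case E: (t 0) => //; case: noI; exists c, t.
have hcons a x c t : t 0 = false -> holds (a :: x) (c, t) = holds x (c, fun i =>
  t i.+1).
  by rewrite /holds /= => ->.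
case E: (s 0).
  (* No equation of [I] constrains the first variable, so a solution of [I'] extends by the bit that
     falsifies [(b, s)]; hence [I'] has no solution and yields 1 = 0. *)
  right; have [||||//|/I1' //] := IH I' true (fun=> false) => //.
  move=> x sx Ix; have : holds ((b (+) ~~ dot (fun i => s i.+1) x) :: x) (b, s).
    apply: sol => [|c t It]; first by rewrite /= sx.
    by rewrite hcons ?(noI0 _ _ It) //; apply/Ix/tl => //; exact: noI0 It.
  by rewrite /holds /= E; case: b {sol} (dot _ x) => -[].
have [||||h|/I1'] := IH I' b (fun i => s i.+1) => //.
- move=> x sx Ix; rewrite -(hcons false) //; apply: sol => [|c t It].
    by rewrite /= sx.
  by rewrite hcons ?(noI0 _ _ It) //; apply/Ix/tl => //; exact: noI0 It.
- by left; apply: lt.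
- by right.
Qed.

(** * Products with the same solutions *)

Lemma all_In (p : pred clause) l : (forall c, List.In c l -> p c) -> all p l.
Proof.
elim: l => //= c l IH h; rewrite h ?IH //; last by left.
by move=> d dl; apply: h; right.
Qed.

Lemma clauses_In n l b s :
  List.In (b, s) l -> clauses n l ;; clausec n b s ≡ clauses n l.
Proof.
elim: l => //= c l IH [->|/IH h]; rewrite -ceq_compA ?h //=.
by rewrite -ccomm_clausec_clauses ceq_compA clausec_idem.
Qed.

(** The equations absorbed by the product contain those of [l] and are closed under addition by
    [clausec_add], so elimination applies; if it yields 1 = 0, that clause absorbs [(b, s)]. *)
Lemma clauses_consequence n l b s :
  (forall x, size x = n -> all (holds x) l -> holds x (b, s)) ->
  clauses n l ;; clausec n b s ≡ clauses n l.
Proof.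
move=> sol; pose I b s := clauses n l ;; clausec n b s ≡ clauses n l.
have [|||x sx Ix|//|h] := @affine_consequence n I b s.
- by move=> c t u tu; rewrite /I (clausec_ext _ tu).
- by rewrite /I clausec0 ceq_idr.
- rewrite /I => c d t u ht hu.
  transitivity (clauses n l ;; (clausec n d u ;; clausec n (c (+) d) (xorf t u))).
    by rewrite ceq_compA hu.
  by rewrite (clausec_comm n d) -clausec_add ceq_compA ht hu.
- apply: sol => //; apply: all_In => -[c t] cl; exact/Ix/(clauses_In n cl).
- by rewrite -h -ceq_compA clausec1_clausec h.
Qed.

Lemma clauses_inj n l l' :
  (forall x, size x = n -> all (holds x) l = all (holds x) l') ->
  clauses n l ≡ clauses n l'.
Proof.
have absorb k k' : (forall x, size x = n -> all (holds x) k -> all (holds x) k') ->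
    clauses n k ;; clauses n k' ≡ clauses n k.
  elim: k' => [|[b s] k' IH] h /=; first by rewrite ceq_idr.
  rewrite ceq_compA clauses_consequence; first by apply: IH => x sx /(h x sx)/andP[].
  by move=> x sx /(h x sx)/andP[].
move=> e; rewrite -(absorb l l') => [|x sx]; last by rewrite e.
by rewrite ccomm_clauses absorb // => x sx; rewrite e.
Qed.

(** * Affine sets of bit strings as solution sets *)

Definition xorb (x y : seq bool) : seq bool := [seq p.1 (+) p.2 | p <- zip x y].

Lemma xorb_cons a b x y : xorb (a :: x) (b :: y) = (a (+) b) :: xorb x y.
Proof. by []. Qed.

Lemma size_xorb n x y : size x = n -> size y = n -> size (xorb x y) = n.
Proof. by move=> sx sy; rewrite size_map size1_zip sx // sy. Qed.

Lemma dot_xorb s x y : size x = size y -> dot s (xorb x y) = dot s x (+) dot s y.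
Proof.
elim: x y s => [|a x IH] [|b y] s // [sxy].
rewrite xorb_cons /= IH //; move: (dot _ x) (dot _ y) => p q.
by case: (s 0) a b p q => -[] [] [] [].
Qed.

Lemma xorbK x y : size x = size y -> xorb x (xorb x y) = y.
Proof.
elim: x y => [|a x IH] [|b y] // [sxy].
by rewrite !xorb_cons IH // addKb.
Qed.

(** Induction on [n] through the halves of [P] with first bit 0 and 1. If both are inhabited, they
    are translates of each other; otherwise an equation pins the first bit. *)
Lemma affine_clauses n (P : seq bool -> Prop) :
  (forall x y z, size x = n -> size y = n -> size z = n ->
     P x -> P y -> P z -> P (xorb (xorb x y) z)) ->
  exists l, forall x, size x = n -> (P x <-> all (holds x) l).
Proof.
elim: n P => [|n IH] P PD.
  have [P0|nP0] := pselect (P [::]).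
    by exists [::] => x /size0nil ->.
  by exists [:: (true, fun=> false)] => x /size0nil ->; split.
have PD' h x y z : size x = n -> size y = n -> size z = n ->
    P (h :: x) -> P (h :: y) -> P (h :: z) -> P (h :: xorb (xorb x y) z).
  move=> sx sy sz Px Py Pz.
  have := PD (h :: x) (h :: y) (h :: z); rewrite !xorb_cons addbb addFb.
  by apply=> //=; rewrite ?sx ?sy ?sz.
have [l0 l0P] := IH (fun x => P (false :: x)) (PD' false).
have [l1 l1P] := IH (fun x => P (true :: x)) (PD' true).
have up0 h x l : all (holds (h :: x)) [seq (c.1, scons false c.2) | c <- l] =
    all (holds x) l by rewrite all_map.
have pin h b x l : all (holds (h :: x)) ((b, scons true (fun=> false)) ::
    [seq (c.1, scons false c.2) | c <- l]) = (h == b) && all (holds x) l.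
  by rewrite [LHS]/= up0 /holds /= dot0 addbF; congr (_ && _); case: b h => -[].
have [[x0 [sx0 Px0]]|no0] := pselect (exists x, size x = n /\ P (false :: x)).
  have [[y0 [sy0 Py0]]|no1] := pselect (exists x, size x = n /\ P (true :: x)).
    pose d := xorb x0 y0; have sd : size d = n by exact: size_xorb.
    (* The half with first bit 1 is the other one translated by [d], so the first bit enters each
       equation with the coefficient that the translation contributes. *)
    exists [seq (c.1, scons (dot c.2 d) c.2) | c <- l0] => -[|h x] // [sx].
    have -> : all (holds (h :: x)) [seq (c.1, scons (dot c.2 d) c.2) | c <- l0] =
        all (holds (if h then xorb d x else x)) l0.
      rewrite all_map; apply: eq_all => c; rewrite /holds /=.
      case: h; rewrite ?andbF // andbT dot_xorb ?sd ?sx //.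
    case: h; last exact: l0P.
    rewrite -l0P ?(size_xorb sd sx) //; split=> [Px|Pdx].
      have := PD (false :: x0) (true :: y0) (true :: x).
      by rewrite !xorb_cons; apply=> //=; rewrite ?sx0 ?sy0 ?sx.
    have := PD (false :: x0) (true :: y0) (false :: xorb d x).
    rewrite !xorb_cons xorbK ?sd ?sx //; apply=> //=; rewrite ?sx0 ?sy0 //.
    by rewrite (size_xorb sd sx).
  exists ((false, scons true (fun=> false)) :: [seq (c.1, scons false c.2) | c <- l0]).
  move=> -[|h x] // [sx]; rewrite pin; case: h => /=; last exact: l0P.
  by split=> // Px; case: no1; exists x.
(* This also covers an empty [P]: the system [l1] then has no solution. *)
exists ((true, scons true (fun=> false)) :: [seq (c.1, scons false c.2) | c <- l1]).
move=> -[|h x] // [sx]; rewrite pin; case: h => /=; first exact: l1P.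
by split=> // Px; case: no0; exists x.
Qed.

Lemma bits_add n (x y : 'rV['F_2]_n) : bits (x + y)%R = xorb (bits x) (bits y).
Proof.
rewrite /xorb /bits; elim: (enum _) => //= i e ->; rewrite mxE; congr (_ :: _).
by move: (x _ _) (y _ _) => [[|[|a]] ia] [[|[|b]] ib].
Qed.

Lemma span_rel_clauses n l (x y : 'rV['F_2]_n) :
  span_rel (H0 (clauses n l)) x y <-> x = y /\ all (holds (bits x)) l.
Proof.
split=> [/H0_sem|[<- h]]; last by apply/H0_sem; rewrite sem_clauses ?size_bits // h.
by rewrite sem_clauses ?size_bits //; case: all => // -[/bits_inj].
Qed.

Theorem mainTheorem5 (n : nat) :
  (forall E : pariso (Z2 n) (Z2 n), pariso_rest_idem E ->
     exists e : circ n n, crest_idem e /\ pariso_eq (H0 e) E) /\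
  (forall e e' : circ n n, crest_idem e -> crest_idem e' ->
     pariso_eq (H0 e) (H0 e') -> e ≡ e').
Proof.
split=> [E /span_eqP EE|e e' /clausal_crest_idem[l el] /clausal_crest_idem[l' el'] ee'].
  (* A restriction idempotent is determined by its domain, the image of [legl E], which is closed
     under the ternary operation. *)
  pose P s := exists a, bits (legl E a) = s.
  have [_ _ _ _ _ _ [a <-] [b <-] [c <-]|l lP] := @affine_clauses n P.
    by exists (tor a b c); rewrite thomP /= !bits_add.
  exists (clauses n l); split; first exact: crest_idem_clauses.
  apply/span_eqP => x y; rewrite span_rel_clauses EE -lP ?size_bits //.
  split=> [[<- [a /bits_inj ax]]|[a <- <-]]; first by exists a.
  by split=> //; exists a.
rewrite el el'; apply: clauses_inj => s ss; have [x xs] := bits_surj ss; rewrite -{}xs.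
have /span_eqP h : span_eq (H0 (clauses n l)) (H0 (clauses n l')).
  apply/span_eqP => u v; have /span_eqP e1 := H0_ceq el;
    have /span_eqP e2 := H0_ceq el'.
  by move/span_eqP: ee' => e3; rewrite -e1 -e2.
(* A product of clauses is the identity on its solutions, so diagonal pairs detect them. *)
have := h x x; rewrite !span_rel_clauses => -[h1 h2].
by apply/idP/idP => hx; [case: h1|case: h2].
Qed.
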